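(* There exists an adaptive randomized algorithm that takes as input $\varepsilon\in(0,1)$, $\delta\in(0,1)$, and access to a $\mathrm{maxsample}$ oracle for an MNL $M$ supported on $[n]$ for $n\in\mathbb{N}$, and with probability at least $1-\delta$ makes $O\left(n\log\left(\frac{n}{\delta}\right)\cdot\left(\frac{1}{\varepsilon^3}+\frac{\log(1/\delta)}{\log n}\right)\right)$ $\mathrm{maxsample}$ queries and solves the MNL Learning Problem with accuracy parameter $\varepsilon$. The algorithm runs in time proportional to its query complexity.
   Context: A multinomial logit model (MNL) $M$ supported on $[n]=\{1,\dots,n\}$ is given by positive weights $w_1,\dots,w_n>0$; for every non-empty $S\subseteq[n]$ it induces the distribution $M_S$ on $S$ with $M_S(i)=w_i/\sum_{j\in S}w_j$. A $\mathrm{maxsample}$ oracle for $M$, given a non-empty slate $S$, returns an item of $S$ drawn from $M_S$, independently across queries. $d_1(M,M')=\max_{\emptyset\neq S\subseteq[n]}\|M_S-M'_S\|_1$. The MNL Learning Problem with accuracy parameter $\varepsilon$: given oracle access to an unknown MNL $M$ on $[n]$, output an MNL $\hat M$ with $d_1(M,\hat M)\le\varepsilon$, represented by the logarithms of its weights. *)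

(* Defs.v *)
From HB Require Import structures.
From mathcomp Require Import all_boot all_order all_algebra.
From mathcomp Require Import all_classical all_reals.
From mathcomp Require Import topology sequences exp.

Set Implicit Arguments.
Unset Strict Implicit.
Unset Printing Implicit Defensive.
Import Order.TTheory GRing.Theory Num.Theory.
Local Open Scope ring_scope.

Record mnl (R : realType) (n : nat) := Mnl {
  weight : 'I_n -> R;
  weight_gt0 : forall i, 0 < weight i }.

(* M_S(i), extended by 0 outside of S. *)
Definition mnl_prob (R : realType) n (M : mnl R n) (S : {set 'I_n}) (i : 'I_n) : R :=
  if i \in S then weight M i / \sum_(j in S) weight M j else 0.

Definition l1_dist (R : realType) n (M M' : mnl R n) (S : {set 'I_n}) : R :=
  \sum_(i < n) `|mnl_prob M S i - mnl_prob M' S i|.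

Definition d1 (R : realType) n (M M' : mnl R n) : R :=
  \big[Num.max/0]_(S : {set 'I_n} | S != finset.set0) l1_dist M M' S.

Definition mnl_of_logs (R : realType) n (theta : 'I_n -> R) : mnl R n :=
  Mnl (fun i => expR_gt0 (theta i)).

(* Algorithms are programs for a randomized random access machine with a real
   RAM component.  The memory consists of arrays (named by a natural number,
   indexed by natural numbers) of natural numbers and of real numbers; an
   expression [NGet a e] or [RGet a e] reads cell [e] of array [a].
   There is no conversion from real to natural numbers, the only real
   constants are natural numbers, and the integer operations are addition,
   truncated subtraction and halving: these restrictions keep unit-cost
   arithmetic from being unreasonably powerful. *)
Inductive nexp : Type :=
  | NConst of nat
  | NGet of nat & nexp
  | NAdd of nexp & nexp
  | NSub of nexp & nexp
  | NHalf of nexp.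

Inductive rexp : Type :=
  | RNat of nexp
  | RGet of nat & nexp
  | RAdd of rexp & rexp
  | RSub of rexp & rexp
  | RMul of rexp & rexp
  | RDiv of rexp & rexp
  | RLn of rexp.

Inductive bexp : Type :=
  | BNLt of nexp & nexp
  | BRLt of rexp & rexp
  | BNot of bexp
  | BAnd of bexp & bexp.

(* [Draw a i e] stores in cell [i] of the integer array [a] a uniform element
   of {0, ..., e - 1}.  [Query a i s e] submits to the maxsample oracle the
   slate whose items are listed in the first [e] cells of the integer array [s],
   and stores the answer in cell [i] of the integer array [a]. *)
Inductive cmd : Type :=
  | Skip
  | NSet (a : nat) (i e : nexp)
  | RSet (a : nat) (i : nexp) (e : rexp)
  | Draw (a : nat) (i e : nexp)
  | Query (a : nat) (i : nexp) (s : nat) (e : nexp)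
  | Seq (c1 c2 : cmd)
  | If (b : bexp) (c1 c2 : cmd)
  | While (b : bexp) (c : cmd).

Fixpoint neval (nm : nat -> nat -> nat) (e : nexp) : nat :=
  match e with
  | NConst k => k
  | NGet a e => nm a (neval nm e)
  | NAdd e1 e2 => (neval nm e1 + neval nm e2)%N
  | NSub e1 e2 => (neval nm e1 - neval nm e2)%N
  | NHalf e => (neval nm e)./2
  end.

Fixpoint reval (R : realType) (nm : nat -> nat -> nat) (rm : nat -> nat -> R)
    (e : rexp) : R :=
  match e with
  | RNat e => (neval nm e)%:R
  | RGet a e => rm a (neval nm e)
  | RAdd e1 e2 => reval nm rm e1 + reval nm rm e2
  | RSub e1 e2 => reval nm rm e1 - reval nm rm e2
  | RMul e1 e2 => reval nm rm e1 * reval nm rm e2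
  | RDiv e1 e2 => reval nm rm e1 / reval nm rm e2
  | RLn e => ln (reval nm rm e)
  end.

Fixpoint beval (R : realType) (nm : nat -> nat -> nat) (rm : nat -> nat -> R)
    (b : bexp) : bool :=
  match b with
  | BNLt e1 e2 => (neval nm e1 < neval nm e2)%N
  | BRLt e1 e2 => reval nm rm e1 < reval nm rm e2
  | BNot b => ~~ beval nm rm b
  | BAnd b1 b2 => beval nm rm b1 && beval nm rm b2
  end.

(* [code] is the stack of commands that remain to be executed. *)
Record config (R : realType) := Config {
  code : seq cmd;
  nmem : nat -> nat -> nat;
  rmem : nat -> nat -> R;
  queries : nat;
  time : nat }.

Definition upd (T : Type) (m : nat -> nat -> T) (a i : nat) (v : T) :=
  fun a' i' => if (a' == a) && (i' == i) then v else m a' i'.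

Definition slate n (nm : nat -> nat -> nat) (s len : nat) : {set 'I_n} :=
  [set i : 'I_n | (i : nat) \in [seq nm s k | k <- iota 0 len]]%SET.

(* The distribution of the next configuration, as a list of pairs
   (probability, configuration).  Item i of [n] is numbered i - 1.
   A command costs one unit of time, whatever the expressions in it, whose
   sizes are constants of the program.  A uniform draw from the empty set and
   a query with an empty slate block the execution forever, without halting. *)
Definition step (R : realType) n (M : mnl R n) (c : config R) :
    seq (R * config R) :=
  let: Config cs nm rm q t := c in
  match cs with
  | [::] => [:: (1, c)]
  | x :: k =>
    match x with
    | Skip => [:: (1, Config k nm rm q t.+1)]
    | NSet a i e =>
        [:: (1, Config k (upd nm a (neval nm i) (neval nm e)) rm q t.+1)]
    | RSet a i e =>
        [:: (1, Config k nm (upd rm a (neval nm i) (reval nm rm e)) q t.+1)]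
    | Draw a i e =>
        let m := neval nm e in
        if m == 0%N then [:: (1, c)] else
        [seq (m%:R^-1, Config k (upd nm a (neval nm i) v) rm q t.+1)
           | v <- iota 0 m]
    | Query a i s e =>
        let S := slate n nm s (neval nm e) in
        if S == finset.set0 then [:: (1, c)] else
        [seq (mnl_prob M S j,
              Config k (upd nm a (neval nm i) (val j)) rm q.+1 t.+1)
           | j <- enum S]
    | Seq c1 c2 => [:: (1, Config (c1 :: c2 :: k) nm rm q t.+1)]
    | If b c1 c2 =>
        [:: (1, Config ((if beval nm rm b then c1 else c2) :: k) nm rm q t.+1)]
    | While b c1 =>
        [:: (1, Config (if beval nm rm b then c1 :: x :: k else k)
                       nm rm q t.+1)]
    end
  end.

Definition halted (R : realType) (c : config R) : bool := nilp (code c).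

(* Probability that the configuration reached from c in T steps satisfies E. *)
Fixpoint prob_at (R : realType) n (M : mnl R n) (T : nat) (E : config R -> bool)
    (c : config R) : R :=
  if T is T'.+1 then \sum_(x <- step M c) x.1 * prob_at M T' E x.2
  else (E c)%:R.

(* Probability that the execution from c halts in a configuration that
   satisfies E.  Halted configurations do not change any more, so the events
   "halted within T steps, in E" increase with T. *)
Definition prob_halt (R : realType) n (M : mnl R n) (E : config R -> bool)
    (c : config R) : R :=
  sup (range (fun T : nat => prob_at M T (fun c' => halted c' && E c') c)).

(* n is in cell 0 of integer array 0; epsilon and delta are in cells 0 and 1 of
   real array 0.  All other cells are 0. *)
Definition init (R : realType) (p : cmd) (n : nat) (eps delta : R) : config R :=
  Config [:: p]
    (upd (fun _ _ => 0%N) 0 0 n)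
    (upd (upd (fun _ _ => 0) 0 0 eps) 0 1 delta)
    0 0.

(* The logarithms of the output weights are in real array 1. *)
Definition output (R : realType) n (c : config R) : mnl R n :=
  mnl_of_logs (fun i : 'I_n => rmem c 1 i).

Definition query_bound (R : realType) (n : nat) (eps delta : R) : R :=
  n%:R * ln (n%:R / delta) * (1 / eps ^+ 3 + ln (1 / delta) / ln n%:R).

(* Main.v *)
Require Import Defs.
From mathcomp Require Import all_boot all_order all_algebra.
From mathcomp Require Import all_classical all_reals.
From mathcomp Require Import topology sequences exp.
From mathcomp Require Import ring lra zify.
Set Implicit Arguments.
Unset Strict Implicit.
Unset Printing Implicit Defensive.
Import Order.TTheory GRing.Theory Num.Theory.
Local Open Scope ring_scope.

(** The learner keeps the set of items that have been picked fewer than [m]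
    times, [m] being of order [ln (n / delta) / eps ^ 3].  In each round it
    queries this set twice: the first answer is the pick, the second one only
    serves to run a clock.  Hence every run makes exactly [2 n m] such queries.

    Let the ideal clock [T] advance by the inverse of the mass [W] of the
    current set in each round.  The number of picks of an item of weight [w]
    minus [w T] is a martingale, so that [w T] is close to [m] when the item is
    removed: [T ^-1] at its removal is, up to a common factor, an estimate of
    [w].  The ideal clock is unknown, but its logarithm grows by about
    [1 / (W T)] per round, and given all the picks, the number [X] of second
    answers that belong to the current set is a sum of independent indicators
    with mean [W T].  The logarithmic clock therefore advances by [X ^-1].

    For a slate [S] with first removed item [h], the error of the logarithmic
    clock between the removals of [h] and [i] is at most of the order of the sum
    of [sqrt (beta / (W T))] times the growth of [ln T].  Weighted by [w_i] and
    summed over [S] this becomes a sum of [sqrt (beta w(S) / T)] times the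
    growth of [ln T], because the items of [S] that remain weigh at most [W] and
    at most [w(S)].  That sum converges; it is of order [w(S) sqrt (beta / m)],
    as [w_h T] is about [m] when [h] is removed.  When [X] is below
    [eps m / 64] the clock is unreliable, but then all the remaining items
    together are negligible in comparison with those removed before, and the
    clock leaps by [ln (16 n / eps)] to make their estimates negligible, too. *)

(** * Executions that fail with bounded probability *)

Section Semantics.
Variables (R : realType) (n : nat) (M : mnl R n).
Implicit Types (c : config R) (S : {set 'I_n}) (E : config R -> bool).

Lemma sum_weight_gt0 S : S != finset.set0 -> 0 < \sum_(j in S) weight M j.
Proof.
case/finset.set0Pn=> i iS; rewrite (bigD1 i) //=.
by rewrite ltr_wpDr ?weight_gt0 // sumr_ge0 // => j _; exact/ltW/weight_gt0.
Qed.

Lemma sum_weight_ge0 S : 0 <= \sum_(j in S) weight M j.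
Proof. by rewrite sumr_ge0 // => j _; exact/ltW/weight_gt0. Qed.

Lemma mnl_prob_ge0 S i : 0 <= mnl_prob M S i.
Proof.
rewrite /mnl_prob; case: ifP => // _.
by rewrite divr_ge0 ?sum_weight_ge0 // ltW ?weight_gt0.
Qed.

Lemma mnl_prob_out S i : i \notin S -> mnl_prob M S i = 0.
Proof. by rewrite /mnl_prob => /negbTE ->. Qed.

Lemma sum_mnl_prob_in S (f : 'I_n -> R) :
  \sum_(j in S) mnl_prob M S j * f j = \sum_j mnl_prob M S j * f j.
Proof.
rewrite [RHS](bigID [in S]) /= [X in _ + X]big1 ?addr0 // => j jS.
by rewrite mnl_prob_out ?mul0r.
Qed.

Lemma sum_mnl_prob_subset (Q S : {set 'I_n}) : Q \subset S ->
  \sum_(j in Q) mnl_prob M S j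
    = (\sum_(j in Q) weight M j) / \sum_(j in S) weight M j.
Proof.
by move=> /fintype.subsetP QS; rewrite mulr_suml; apply: eq_bigr => j /QS jS;
  rewrite /mnl_prob jS.
Qed.

Lemma sum_mnl_prob S : S != finset.set0 -> \sum_j mnl_prob M S j = 1.
Proof.
move=> S0; under eq_bigr do rewrite -[mnl_prob _ _ _]mulr1.
rewrite -sum_mnl_prob_in; under eq_bigr do rewrite mulr1.
by rewrite sum_mnl_prob_subset // divff // gt_eqF // sum_weight_gt0.
Qed.

Lemma sum_mnl_prob_le1 S : \sum_j mnl_prob M S j <= 1.
Proof.
have [->|S0] := eqVneq S finset.set0; last by rewrite sum_mnl_prob.
by rewrite big1 // => j _; rewrite mnl_prob_out ?finset.inE.
Qed.

Lemma step_ge0 c x : List.In x (step M c) -> 0 <= x.1.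
Proof.
have map0 (I : Type) (f : I -> R) (g : I -> config R) s :
    (forall i, 0 <= f i) -> List.In x [seq (f i, g i) | i <- s] -> 0 <= x.1.
  by move=> f0; elim: s => [|i s IH] //= [<-|/IH//] /=.
case: c => [[|[|a i e|a i e|a i e|a i s e|c1 c2|b c1 c2|b c1] cs] nm rm q t] /=;
  try by case=> // <- /=.
- case: eqP => [_ [<-|//]|_] //=; apply: (map0 _ (fun=> _)) => v.
  by rewrite invr_ge0.
- case: eqP => [_ [<-|//]|_] //=; apply: (map0 _ (mnl_prob M _)) => v.
  exact: mnl_prob_ge0.
Qed.

Lemma sum_step c : \sum_(x <- step M c) x.1 = 1.
Proof.
case: c => [[|[|a i e|a i e|a i e|a i s e|c1 c2|b c1 c2|b c1] cs] nm rm q t] /=;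
  rewrite ?big_seq1 //.
- case: eqP => [_|/eqP e0]; rewrite ?big_seq1 // big_map /=.
  rewrite big_const_seq count_predT size_iota iter_addr_0 -[LHS]mulr_natr mulVf //.
  by rewrite pnatr_eq0.
- case: eqP => [_|/eqP e0]; rewrite ?big_seq1 // big_map /= big_enum /=.
  under eq_bigr do rewrite -[mnl_prob _ _ _]mulr1.
  rewrite sum_mnl_prob_in; under eq_bigr do rewrite mulr1.
  exact: sum_mnl_prob.
Qed.

Lemma ler_sum_In (I : Type) (s : seq I) (f g : I -> R) :
  (forall x, List.In x s -> f x <= g x) ->
  \sum_(x <- s) f x <= \sum_(x <- s) g x.
Proof.
elim: s => [|x s IH] fg; first by rewrite !big_nil.
rewrite !big_cons lerD ?fg //=; first by left.
by apply: IH => y ys; apply: fg; right.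
Qed.

Lemma eq_sum_In (I : Type) (s : seq I) (f g : I -> R) :
  (forall x, List.In x s -> f x = g x) ->
  \sum_(x <- s) f x = \sum_(x <- s) g x.
Proof.
by move=> fg; apply: le_anti; rewrite !ler_sum_In // => x /fg ->.
Qed.

Lemma prob_at_ge0 T E c : 0 <= prob_at M T E c.
Proof.
elim: T c => [|T IH] c /=; first by rewrite ler0n.
suff : \sum_(x <- step M c) (0 : R) <= \sum_(x <- step M c) x.1 * prob_at M T E x.2.
  by rewrite big1_eq.
by apply: ler_sum_In => x xc; rewrite mulr_ge0 // (step_ge0 xc).
Qed.

Lemma prob_at_le1 T E c : prob_at M T E c <= 1.
Proof.
elim: T c => [|T IH] c /=; first by rewrite lern1 leq_b1.
rewrite -(sum_step c); apply: ler_sum_In => x xc.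
by rewrite ler_piMr // (step_ge0 xc).
Qed.

Lemma prob_at_invariant (P : config R -> Prop) E c :
  (forall c' x, P c' -> List.In x (step M c') -> P x.2) ->
  (forall c', P c' -> E c') -> P c ->
  forall T, prob_at M T E c = 1.
Proof.
move=> stepP PE Pc T; elim: T c Pc => [|T IH] c Pc /=; first by rewrite PE.
rewrite -(sum_step c); apply: eq_sum_In => x xc.
by rewrite IH ?mulr1 //; exact: stepP xc.
Qed.

Definition halts_in E c := halted c && E c.

Lemma prob_at_leS T E c :
  prob_at M T (halts_in E) c <= prob_at M T.+1 (halts_in E) c.
Proof.
elim: T c => [|T IH] c.
  case: c => [[|x k] nm rm q t]; first by rewrite /= big_seq1 mul1r.
  exact: (prob_at_ge0 1).
by apply: ler_sum_In => x xc; rewrite ler_wpM2l // (step_ge0 xc).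
Qed.

Lemma prob_at_leW T T' E c : (T <= T')%N ->
  prob_at M T (halts_in E) c <= prob_at M T' (halts_in E) c.
Proof.
move=> /subnKC <-; elim: (T' - T)%N => [|d IH]; first by rewrite addn0.
by rewrite addnS (le_trans IH) // prob_at_leS.
Qed.

(** A bound at one finite time is enough: the probability of having halted in [E] increases with the
    time, and [prob_halt] is its supremum. *)
Definition fails_within E c (phi : R) :=
  exists T, 1 - phi <= prob_at M T (halts_in E) c.

Lemma fails_within_halt E c : halted c -> E c -> fails_within E c 0.
Proof. by move=> hc Ec; exists 0; rewrite /= /halts_in hc Ec subr0. Qed.

Lemma fails_within_ge1 E c phi : 1 <= phi -> fails_within E c phi.
Proof. by move=> p1; exists 0; rewrite (le_trans _ (prob_at_ge0 _ _ _)) ?subr_le0. Qed.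

Lemma fails_within_le E c phi psi :
  phi <= psi -> fails_within E c phi -> fails_within E c psi.
Proof. by move=> le [T h]; exists T; rewrite (le_trans _ h) // lerD2l lerN2. Qed.

Lemma fails_within_det E c c' phi :
  step M c = [:: (1, c')] -> fails_within E c' phi -> fails_within E c phi.
Proof. by move=> sc [T HT]; exists T.+1; rewrite /= sc big_seq1 mul1r. Qed.

Lemma fails_within_query E a i s e k nm rm q t (phi : 'I_n -> R) :
  let S := slate n nm s (neval nm e) in
  S != finset.set0 ->
  (forall j, j \in S ->
     fails_within E (Config k (upd nm a (neval nm i) (val j)) rm q.+1 t.+1) (phi j)) ->
  fails_within E (Config (Query a i s e :: k) nm rm q t)
    (\sum_j mnl_prob M S j * phi j).
Proof.
move=> S S0 H; pose c := Config (Query a i s e :: k) nm rm q t.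
have sE : step M c = [seq (mnl_prob M S j,
    Config k (upd nm a (neval nm i) (val j)) rm q.+1 t.+1) | j <- enum S].
  by rewrite /step /c -/S (negbTE S0).
set D := fun j : 'I_n => Config k (upd nm a (neval nm i) (val j)) rm q.+1 t.+1.
suff [T HT] : exists T, forall j, j \in S ->
    1 - phi j <= prob_at M T (halts_in E) (D j).
  exists T.+1; rewrite /prob_at -/prob_at sE big_map big_enum /=.
  rewrite -sum_mnl_prob_in -{1}(sum_mnl_prob S0).
  under [X in X - _]eq_bigr do rewrite -[mnl_prob _ _ _]mulr1.
  rewrite -sum_mnl_prob_in -sumrB; apply: ler_sum => j jS.
  by rewrite -mulrBr ler_wpM2l ?mnl_prob_ge0 ?HT.
have : forall j, exists T, j \in S -> 1 - phi j <= prob_at M T (halts_in E) (D j).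
  move=> j; case: (boolP (j \in S)) => [/H[T HT]|]; last by exists 0.
  by exists T.
(* There are finitely many answers, so by monotonicity the largest of their times serves for all of
   them. *)
move=> /choice[T HT]; exists (\max_j T j)%N => j jS.
by rewrite (le_trans (HT j jS)) // prob_at_leW // leq_bigmax.
Qed.

Lemma le_prob_halt E c phi : fails_within E c phi -> 1 - phi <= prob_halt M E c.
Proof.
move=> [T HT]; rewrite (le_trans HT) //; apply: ub_le_sup; last by exists T.
by exists 1 => _ [T' _ <-]; exact: prob_at_le1.
Qed.

End Semantics.

(** * Accuracy of the clock *)

Section RealInequalities.
Variable R : realType.
Implicit Types v x : R.

Lemma expR_sub_sqr_le v : -4^-1 <= v <= 4^-1 -> expR (v - v ^+ 2) <= 1 + v.
Proof.
move=> /andP[v1 v2].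
suff H : 1 <= (1 + v) * expR (v ^+ 2 - v).
  by rewrite -opprB expRN -[leLHS]mul1r ler_pdivrMr // expR_gt0.
have [v0|v0] := leP 0 v.
  have h := expR_ge1Dx (v ^+ 2 - v).
  suff : 1 <= (1 + v) * (1 + (v ^+ 2 - v)).
    by move=> /le_trans; apply; rewrite ler_wpM2l //; lra.
  have : 0 <= v ^+ 3 by rewrite exprn_ge0.
  by nra.
(* For negative [v] the tangent bound used above would only give [1 + v ^ 3 < 1]. Applying it to
   half the exponent and squaring recovers enough of the second-order term. *)
have h : (1 + (v ^+ 2 - v) / 2) ^+ 2 <= expR (v ^+ 2 - v).
  rewrite [X in expR X](_ : _ = (v ^+ 2 - v) / 2 + (v ^+ 2 - v) / 2); last by field.
  rewrite expRD -expr2 ler_sqr ?nnegrE ?expR_ge0 ?expR_ge1Dx //; nra.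
suff : 1 <= (1 + v) * (1 + (v ^+ 2 - v) / 2) ^+ 2.
  by move=> /le_trans; apply; rewrite ler_wpM2l //; lra.
have -> : (1 + v) * (1 + (v ^+ 2 - v) / 2) ^+ 2 = 
  1 + v ^+ 2 / 4 * (1 + 3 * v - v ^+ 2 + v ^+ 3) by field.
rewrite lerDl mulr_ge0 //; first by rewrite divr_ge0 ?sqr_ge0.
nra.
Qed.

(** The right-hand side is the integral of [expR (- (x / 4))] from [a] to [b], the left-hand side
    its right-endpoint rectangle. This makes the sum of the round costs telescope. *)
Lemma mulBr_expR_le (a b : R) :
  expR (- (b / 4)) * (b - a) <= 4 * (expR (- (a / 4)) - expR (- (b / 4))).
Proof.
have -> : expR (- (a / 4)) = expR (- (b / 4)) * expR ((b - a) / 4).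
  by rewrite -expRD; congr expR; field.
have h := expR_ge1Dx ((b - a) / 4).
rewrite [leRHS](_ : _ = expR (- (b / 4)) * (4 * (expR ((b - a) / 4) - 1))).
  rewrite ler_wpM2l ?expR_ge0 //.
  by move: (expR _) h => E h; lra.
by ring.
Qed.

Lemma sqrtr_le (y z : R) : 0 <= z -> y <= z ^+ 2 -> Num.sqrt y <= z.
Proof. by move=> z0 yz; rewrite -(ger0_norm z0) -sqrtr_sqr ler_wsqrtr. Qed.

Lemma ler_norm_expRB1 (x y : R) : `|x| <= y -> `|expR x - 1| <= expR y - 1.
Proof.
move=> xy; have [x0|x0] := leP 0 x.
  rewrite ger0_norm; last by rewrite subr_ge0 -expR0 ler_expR.
  by rewrite lerD2r ler_expR (le_trans (ler_norm _)).
rewrite ler0_norm ?subr_le0 ?expR_le1 ?(ltW x0) // opprB.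
have h1 : 1 + x <= expR x := expR_ge1Dx _.
have h2 : 1 + y <= expR y := expR_ge1Dx _.
move: xy; rewrite ltr0_norm // => xy; lra.
Qed.

End RealInequalities.

Section RoundError.
Variable R : realType.

(* The rate [X^-1] at which the algorithm advances its logarithmic clock in a
   round, against the growth [ln (t' / t)] of the logarithm of the ideal
   clock. *)
Lemma clock_increment_error (W t B beta X : R) :
    let t' := t + W^-1 in let mu := W * t' in
    0 < W -> 0 < t -> 1 <= beta -> 288 * beta <= B ->
    `|X - mu| <= Num.sqrt (beta * Num.max mu (B / 2)) -> B <= X ->
  `|X^-1 - ln (t' / t)| <= 3 * Num.sqrt (beta / mu) * ln (t' / t)
  /\ 3 * Num.sqrt (beta / mu) <= 4^-1.
Proof.
move=> t' mu W0 t0 b1 bB dev BX.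
have W'0 : 0 < W^-1 by rewrite invr_gt0.
have t'0 : 0 < t' by rewrite addr_gt0.
have mu0 : 0 < mu by rewrite mulr_gt0.
(* A mean below [B / 2] would allow a deviation of at most [B / 2] and so put [X] below [B]. *)
have muB : B / 2 <= mu.
  rewrite leNgt; apply/negP => muB.
  suff : Num.sqrt (beta * Num.max mu (B / 2)) <= B / 2.
    by move: dev => /ler_normlP[_] dev h; lra.
  rewrite max_r ?(ltW muB) // sqrtr_le //; nra.
rewrite max_l // in dev.
set s := Num.sqrt (beta / mu).
have s0 : 0 <= s := sqrtr_ge0 _.
have s2 : s ^+ 2 = beta / mu by rewrite sqr_sqrtr // divr_ge0 ?(ltW mu0) //; lra.
have smu : Num.sqrt (beta * mu) = s * mu.
  rewrite (_ : beta * mu = (s * mu) ^+ 2).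
    by rewrite sqrtr_sqr ger0_norm // mulr_ge0 // ltW.
  by rewrite exprMn s2; field; rewrite gt_eqF.
have s12 : s <= 12^-1.
  rewrite sqrtr_le //; first by lra.
  by rewrite ler_pdivrMr //; nra.
rewrite smu in dev.
set x := mu^-1.
have x0 : 0 < x by rewrite invr_gt0.
have xmu : x * mu = 1 by rewrite mulVf // gt_eqF.
have xs : x <= s / 12.
  have : x <= s ^+ 2 by rewrite s2 ler_pdivlMr // xmu.
  by nra.
have X0 : 0 < X by nra.
have XV : X^-1 * X = 1 by rewrite mulVf // gt_eqF.
have XV0 : 0 < X^-1 by rewrite invr_gt0.
have Xmu : 11 / 12 * mu <= X.
  by move: dev => /ler_normlP[d1 d2]; nra.
have XVx : X^-1 <= 12 / 11 * x.
  rewrite -[leLHS]mul1r ler_pdivrMr //.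
  have : x * (11 / 12 * mu) <= x * X by rewrite ler_wpM2l // ltW.
  by nra.
have d1 : `|X^-1 - x| <= 12 / 11 * s * x.
  have -> : X^-1 - x = (mu - X) * (X^-1 * x).
    by rewrite /x; field; rewrite !gt_eqF.
  rewrite normrM distrC [`|_ * x|]gtr0_norm ?mulr_gt0 //.
  apply: (le_trans (ler_wpM2r _ dev)); first by rewrite ltW // mulr_gt0.
  have -> : s * mu * (X^-1 * x) = s * X^-1 * (x * mu) by ring.
  by rewrite xmu mulr1 mulrC; nra.
(* The growth of the logarithm is [- ln (1 - x)] with [x = mu^-1], which lies between [x] and
   [x + x ^ 2]. Both rates are compared with [x]. *)
have xE : t / t' = 1 - x.
  by rewrite -[t in LHS](addrK W^-1) -/t' mulrBl divff ?gt_eqF // /x /mu invfM.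
have lnE : ln (t' / t) = - ln (1 - x) by rewrite -xE -[t' / t]invf_div lnV // posrE divr_gt0.
have g1 : x <= ln (t' / t).
  rewrite lnE lerNr -[leRHS]expRK ler_ln ?posrE ?expR_gt0 -?xE ?divr_gt0 //.
  by rewrite xE expR_ge1Dx.
have g2 : ln (t' / t) <= x + x ^+ 2.
  rewrite lnE lerNl -[leLHS]expRK ler_ln ?posrE ?expR_gt0 -?xE ?divr_gt0 //.
  rewrite xE (_ : - (x + x ^+ 2) = - x - (- x) ^+ 2); last by ring.
  by apply: expR_sub_sqr_le; lra.
split; last by lra.
have d2 : `|x - ln (t' / t)| <= s / 12 * x by rewrite ler0_norm; [nra|lra].
have := ler_normD (X^-1 - x) (x - ln (t' / t)).
rewrite addrA subrK => /le_trans; apply.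
apply: (le_trans (lerD d1 d2)).
have : s * x <= s * ln (t' / t) by rewrite ler_wpM2l.
by nra.
Qed.

(** With a mean above [2 * B] the deviation would be at most half the mean, leaving [X] above [B]. A
    leap therefore certifies that little mass is alive. *)
Lemma small_count_small_mean (B beta mu X : R) :
  1 <= beta -> 288 * beta <= B ->
  `|X - mu| <= Num.sqrt (beta * Num.max mu (B / 2)) -> X < B -> mu <= 2 * B.
Proof.
move=> b1 bB dev XB; rewrite leNgt; apply/negP => muB.
rewrite max_l in dev; last by lra.
have : Num.sqrt (beta * mu) <= mu / 2 by rewrite sqrtr_le //; nra.
by move: dev => /ler_normlP[]; lra.
Qed.

End RoundError.

Lemma expRB1_le_mul (R : realType) (a : R) : expR a - 1 <= a * expR a.
Proof.
have : (1 - a) * expR a <= expR (- a) * expR a.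
  by rewrite ler_wpM2r ?expR_ge0 // expR_ge1Dx.
by rewrite -expRD addNr expR0; lra.
Qed.

(** * From the errors of the clock to the errors of weight ratios on a slate *)

Section Clocks.
Variables (R : realType) (n : nat) (w : 'I_n -> R) (k : 'I_n -> nat).
Variables (X : nat -> R) (eps m : R).

(** [k j] stands for the removal round of [j], so that [j] belongs to the slates of exactly the
    rounds below [k j]; [X r] stands for the count of second answers that drives the clock in round
    [r]. *)
Definition alive_mass r := \sum_(j | (r < k j)%N) w j.
Definition ideal_clock r := \sum_(i < r) (alive_mass i)^-1.
Definition leap r := 64 * X r < eps * m.
Definition log_rate r := if leap r then ln (16 * n%:R / eps) else (X r)^-1.
Definition log_clock r := \sum_(i < r) log_rate i.

Variable beta : R.
Local Notation B := (eps * m / 64).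
Hypothesis w0 : forall j, 0 < w j.
Hypothesis k0 : forall j, (0 < k j)%N.
Hypothesis eps01 : 0 < eps < 1.
Hypothesis m0 : 0 < m.
Hypothesis beta1 : 1 <= beta.
Hypothesis beta_m : 2 ^+ 19 * beta <= eps ^+ 2 * m.
Hypothesis removal_mean : forall j, `|w j * ideal_clock (k j) - m| <= eps / 64 * m.
Hypothesis count_mean : forall r, [exists j, (r < k j)%N] ->
  let mu := alive_mass r * ideal_clock r.+1 in
  `|X r - mu| <= Num.sqrt (beta * Num.max mu (B / 2)).

Let eps0 : 0 < eps. Proof. by case/andP: eps01. Qed.
Let eps1 : eps < 1. Proof. by case/andP: eps01. Qed.
Let B0 : 0 < B. Proof. by rewrite divr_gt0 // mulr_gt0. Qed.
Let betaB : 288 * beta <= B.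
Proof.
rewrite ler_pdivlMr //; apply: (@le_trans _ _ (2 ^+ 19 * beta)).
  by have b1 := beta1; lra.
by apply: (le_trans beta_m); rewrite expr2 -mulrA ler_piMl ?mulr_ge0 // ltW.
Qed.

Lemma leapE r : leap r = (X r < B).
Proof. by rewrite /leap ltr_pdivlMr // mulrC. Qed.

Lemma alive_mass_ge0 r : 0 <= alive_mass r.
Proof. by rewrite sumr_ge0 // => j _; exact: ltW. Qed.

Lemma alive_mass_gt0 r i : (r < k i)%N -> 0 < alive_mass r.
Proof.
move=> ri; rewrite /alive_mass (bigD1 i) //= ltr_wpDr // sumr_ge0 // => j _.
exact: ltW.
Qed.

Lemma ideal_clockS r : ideal_clock r.+1 = ideal_clock r + (alive_mass r)^-1.
Proof. by rewrite /ideal_clock big_ord_recr. Qed.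

Lemma ideal_clock_le r s : (r <= s)%N -> ideal_clock r <= ideal_clock s.
Proof.
move=> /subnKC <-; elim: (s - r)%N => [|d IH]; first by rewrite addn0.
by rewrite addnS ideal_clockS (le_trans IH) // lerDl invr_ge0 alive_mass_ge0.
Qed.

Lemma ideal_clock_gt0 (i : 'I_n) r : (0 < r)%N -> 0 < ideal_clock r.
Proof.
move=> r0; apply: lt_le_trans (ideal_clock_le r0).
by rewrite ideal_clockS /ideal_clock big_ord0 add0r invr_gt0 (alive_mass_gt0 (k0 i)).
Qed.

Variables (S : {set 'I_n}) (h : 'I_n).
Hypothesis hS : h \in S.
Hypothesis h_first : forall i, i \in S -> (k h <= k i)%N.

Let T0 := ideal_clock (k h).
Let T0_gt0 : 0 < T0. Proof. exact: ideal_clock_gt0. Qed.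
Let clock_gt0 r : (k h <= r)%N -> 0 < ideal_clock r.
Proof. by move=> hr; apply: lt_le_trans (ideal_clock_le hr). Qed.

Let u r := ln (ideal_clock r / T0).
(** The error allowed in round [r] by [clock_increment_error]. Leap rounds contribute nothing
    because items removed after a leap are treated separately. *)
Let y r := if leap r then 0 else
  3 * Num.sqrt (beta / (alive_mass r * ideal_clock r.+1)) * (u r.+1 - u r).
Let G r := \sum_(k h <= s < r) y s.

Let u_diff r : (k h <= r)%N -> u r.+1 - u r = ln (ideal_clock r.+1 / ideal_clock r).
Proof.
move=> hr; have r0 := clock_gt0 hr; have r1 := clock_gt0 (leqW hr).
rewrite /u !ln_div ?posrE //; ring.
Qed.

Let u_diff_ge0 r : (k h <= r)%N -> 0 <= u r.+1 - u r.
Proof.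
move=> hr; rewrite u_diff // ln_ge0 // ler_pdivlMr ?clock_gt0 // mul1r.
exact: ideal_clock_le.
Qed.

Let round_bounds r i : (k h <= r)%N -> (r < k i)%N -> ~~ leap r ->
  `|(X r)^-1 - (u r.+1 - u r)| <= y r /\ 0 <= y r <= (u r.+1 - u r) / 4.
Proof.
move=> hr ri nl; have u0 := u_diff_ge0 hr; move: u0.
have H : [exists j, (r < k j)%N] by apply/existsP; exists i.
have /= {}H := count_mean H; rewrite /y (negbTE nl) u_diff // ideal_clockS in H * => u0.
have BX : B <= X r by rewrite leNgt -leapE.
have [-> le4] := clock_increment_error (alive_mass_gt0 ri) (clock_gt0 hr) beta1 betaB H BX.
by rewrite !mulr_ge0 ?sqrtr_ge0 //= [leRHS]mulrC ler_wpM2r.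
Qed.

Let y_le r i : (k h <= r)%N -> (r < k i)%N -> 0 <= y r <= (u r.+1 - u r) / 4.
Proof.
move=> hr ri; have [l|nl] := boolP (leap r); last by have [] := round_bounds hr ri nl.
by rewrite /y l lexx divr_ge0 // u_diff_ge0.
Qed.

Let sumB (f : nat -> R) p q : (p <= q)%N ->
  \sum_(i < q) f i - \sum_(i < p) f i = \sum_(p <= i < q) f i.
Proof.
by move=> pq; rewrite -!(big_mkord xpredT f) (big_cat_nat (n := p)) //= addrAC subrr add0r.
Qed.

Let u_start : u (k h) = 0. Proof. by rewrite /u divff ?ln1 // gt_eqF. Qed.

Let u_sum r : (k h <= r)%N -> u r = \sum_(k h <= s < r) (u s.+1 - u s).
Proof. by move=> hr; rewrite telescope_sumr // u_start subr0. Qed.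

Let clock_error i : i \in S -> (forall r, (k h <= r < k i)%N -> ~~ leap r) ->
  `|u (k i) - (log_clock (k i) - log_clock (k h))| <= G (k i).
Proof.
move=> iS nl; have hi := h_first iS.
rewrite /log_clock sumB // u_sum // -sumrB.
apply: (le_trans (ler_norm_sum _ _ _)); rewrite /G big_nat [leRHS]big_nat.
apply: ler_sum => r hri; have /andP[hr ri] := hri.
by rewrite distrC /log_rate (negbTE (nl _ hri)); have [] := round_bounds hr ri (nl _ hri).
Qed.

Let G_S r : (k h <= r)%N -> G r.+1 = G r + y r.
Proof. by move=> hr; rewrite /G big_nat_recr. Qed.

(** Telescoping distributes the drift over the rounds, so that it can later be summed over the items
    first. *)
Let expG i : i \in S ->
  expR (G (k i)) - 1 <= \sum_(k h <= r < k i) y r * expR (G r.+1).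
Proof.
move=> iS; have -> : 1 = expR (G (k h)) by rewrite /G big_geq // expR0.
rewrite -(telescope_sumr (expR \o G) (h_first iS)) big_nat [leRHS]big_nat.
apply: ler_sum => r /andP[hr ri] /=; rewrite G_S // expRD.
by rewrite mulrCA -[X in _ - X]mulr1 -mulrBr ler_wpM2l ?expR_ge0 ?expRB1_le_mul.
Qed.

(** This crude bound makes [expR G] cost at most [expR (u / 4)], which the decay [expR (- (u / 2))]
    in [V_rho] absorbs. *)
Let G_le r i : (k h <= r)%N -> (r <= k i)%N -> G r <= u r / 4.
Proof.
move=> hr ri; rewrite u_sum // mulr_suml.
rewrite /G big_nat [leRHS]big_nat; apply: ler_sum => s /andP[hs sr].
by have /andP[] := y_le hs (leq_trans sr ri).
Qed.

Let VS := \sum_(i in S) w i.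
Let V r := \sum_(i in S | (r < k i)%N) w i.
Let theta := Num.sqrt (2 * beta / m).

Let VS_ge : w h <= VS.
Proof.
by rewrite /VS (bigD1 h) //= lerDl sumr_ge0 // => i _; exact: ltW.
Qed.

Let VS_gt0 : 0 < VS. Proof. exact: lt_le_trans VS_ge. Qed.

Let V_bounds r : [/\ 0 <= V r, V r <= VS & V r <= alive_mass r].
Proof.
have wge0 j : 0 <= w j by exact: ltW.
split; first by rewrite sumr_ge0.
- by rewrite /VS (bigID (fun i => (r < k i)%N)) /= lerDl sumr_ge0.
- rewrite /alive_mass (bigID [in S]) /= /V.
  under eq_bigl do rewrite andbC.
  by rewrite lerDl sumr_ge0.
Qed.

Let removal_bounds i : m * (1 - eps / 64) <= w i * ideal_clock (k i) <= m * (1 + eps / 64).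
Proof. by have /ler_normlP[] := removal_mean i; move=> h1 h2; apply/andP; split; lra. Qed.

Let m_le i : m <= 2 * (w i * ideal_clock (k i)).
Proof.
have /andP[+ _] := removal_bounds i.
have e1 := eps1; have m1 := m0; move=> H.
have : m * (eps / 64) <= m * 2^-1 by rewrite ler_pM2l //; lra.
by lra.
Qed.

Let theta_ge0 : 0 <= theta. Proof. exact: sqrtr_ge0. Qed.

Let expu r : (k h <= r)%N -> expR (- u r) = T0 / ideal_clock r.
Proof.
move=> hr; rewrite expRN /u lnK ?invf_div // posrE divr_gt0 //.
exact: clock_gt0.
Qed.

(** As [V r] is at most [VS] and at most the alive mass, its square divided by the alive mass is at
    most [VS]. The bound [m <= 2 * w h * T0 <= 2 * VS * T0] then expresses the clock through [theta]
    and [u]. *)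
Let V_rho r i : (k h <= r)%N -> (r < k i)%N ->
  V r * Num.sqrt (beta / (alive_mass r * ideal_clock r.+1))
    <= theta * VS * expR (- (u r.+1 / 2)).
Proof.
move=> hr ri; have [V0 V1 V2] := V_bounds r.
have t0 := clock_gt0 (leqW hr); have W0 := alive_mass_gt0 ri.
have rhs0 : 0 <= VS * expR (- (u r.+1 / 2)) by rewrite mulr_ge0 ?expR_ge0 // ltW.
have b0 : 0 < beta by exact: lt_le_trans beta1.
rewrite -[V r]ger0_norm // -sqrtr_sqr -sqrtrM ?sqr_ge0 //.
rewrite -mulrA -[X in _ <= _ * X]ger0_norm // -sqrtr_sqr -sqrtrM; last first.
  by rewrite divr_ge0 ?mulr_ge0 // ltW.
apply: ler_wsqrtr; rewrite exprMn -expRM_natl.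
rewrite (_ : 2%:R * - (u r.+1 / 2) = - u r.+1); last by field.
rewrite expu ?leqW // [leLHS](_ : _ = (V r ^+ 2 / alive_mass r) * (beta / ideal_clock r.+1)); last first.
  by field; rewrite !gt_eqF.
rewrite [leRHS](_ : _ = (VS * (VS * T0 * 2 / m)) * (beta / ideal_clock r.+1)); last first.
  by field; rewrite !gt_eqF.
rewrite ler_wpM2r ?divr_ge0 ?(ltW b0) ?(ltW t0) //.
apply: (@le_trans _ _ VS).
  rewrite ler_pdivrMr // expr2 ler_pM //.
rewrite ler_peMr ?(ltW VS_gt0) // ler_pdivlMr // mul1r.
apply: (le_trans (m_le h)); rewrite mulrC ler_wpM2r // ler_wpM2r // ltW //.
Qed.

(** The factors from [V_rho] and [G_le] combine to [expR (- (u r.+1 / 4))], and its product with the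
    growth of [u] is bounded by a difference through [mulBr_expR_le]. *)
Let round_cost r : (k h <= r)%N ->
  V r * (y r * expR (G r.+1))
    <= 12 * theta * VS * (expR (- (u r / 4)) - expR (- (u r.+1 / 4))).
Proof.
move=> hr; have ud := u_diff_ge0 hr.
have tV : 0 <= theta * VS by rewrite mulr_ge0 // ltW.
have rhs0 : 0 <= 12 * theta * VS * (expR (- (u r / 4)) - expR (- (u r.+1 / 4))).
  apply: mulr_ge0; first by rewrite -mulrA mulr_ge0.
  by rewrite subr_ge0 ler_expR lerN2 ler_wpM2r ?invr_ge0 // -subr_ge0.
have [/exists_inP[i iS ri]|/exists_inPn none] := boolP [exists i in S, (r < k i)%N]; last first.
  rewrite /V big1 ?mul0r // => i /andP[iS ri].
  by have := none _ iS; rewrite ri.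
have [V0 _ _] := V_bounds r.
have [l|nl] := boolP (leap r); first by rewrite /y l mul0r mulr0.
have Gu := G_le (leqW hr) ri.
have Vr := V_rho hr ri.
apply: (@le_trans _ _ (3 * (theta * VS * expR (- (u r.+1 / 2))) * (u r.+1 - u r) * expR (u r.+1 / 4))).
  rewrite /y (negbTE nl) [V r * _]mulrA; apply: ler_pM; rewrite ?expR_ge0 ?ler_expR //.
    exact: mulr_ge0 V0 (mulr_ge0 (mulr_ge0 (ler0n _ 3) (sqrtr_ge0 _)) ud).
  by rewrite [leLHS]mulrA ler_wpM2r // mulrCA ler_wpM2l.
rewrite [leLHS](_ : _ = 3 * (theta * VS) *
    (expR (- (u r.+1 / 4)) * (u r.+1 - u r))); last first.
  rewrite (_ : expR (- (u r.+1 / 4)) = expR (- (u r.+1 / 2)) * expR (u r.+1 / 4)).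
    by ring.
  by rewrite -expRD; congr expR; field.
rewrite [leRHS](_ : _ = 3 * (theta * VS) *
    (4 * (expR (- (u r / 4)) - expR (- (u r.+1 / 4))))); last by ring.
by rewrite ler_wpM2l ?mulr_ge0 ?mulBr_expR_le // ltW.
Qed.

Let drift_cost : \sum_(i in S) w i * (expR (G (k i)) - 1) <= 12 * theta * VS.
Proof.
pose N := \max_(i in S) k i.
have kN i : i \in S -> (k i <= N)%N by move=> iS; exact: leq_bigmax_cond.
apply: (@le_trans _ _ (\sum_(i in S) \sum_(k h <= r < N | (r < k i)%N)
    w i * (y r * expR (G r.+1)))).
  apply: ler_sum => i iS; rewrite -mulr_sumr ler_wpM2l ?(ltW (w0 i)) //.
  rewrite (le_trans (expG iS)) // (big_nat_widen _ _ _ _ _ (kN i iS)).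
  exact: lexx.
(* After the exchange the weights in round [r] add up to [V r], the mass of the items of [S] still
   alive. *)
rewrite (exchange_big_dep xpredT) //= big_nat.
under eq_bigr do rewrite -mulr_suml -/(V _).
apply: (@le_trans _ _ (\sum_(k h <= r < N)
    12 * theta * VS * (expR (- (u r / 4)) - expR (- (u r.+1 / 4))))).
  by rewrite [leRHS]big_nat; apply: ler_sum => r /andP[hr _]; exact: round_cost.
rewrite -mulr_sumr -[leRHS]mulr1 ler_wpM2l ?mulr_ge0 ?(ltW VS_gt0) //.
rewrite (@telescope_sumr_eq _ _ _ (fun r => - expR (- (u r / 4)))) ?kN //; last first.
  by move=> r _; rewrite opprK addrC.
by rewrite u_start mul0r oppr0 expR0 opprK addrC lerBlDr lerDl expR_ge0.
Qed.

Let early i := ~~ has leap (index_iota (k h) (k i)).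

(** The ideal estimate [T0 / ideal_clock (k i)] mediates: it differs from the true ratio by the two
    removal errors, and from the computed estimate by the exponential of the clock error. *)
Let early_error i : i \in S -> early i ->
  `|w i / w h - expR (log_clock (k h) - log_clock (k i))|
    <= w i / w h * (eps / 16 + 2 * (expR (G (k i)) - 1)).
Proof.
move=> iS /hasPn nl; have hi := h_first iS.
have {}nl r : (k h <= r < k i)%N -> ~~ leap r by move=> ?; apply: nl; rewrite mem_index_iota.
have err := clock_error iS nl.
set x := log_clock (k i) - log_clock (k h) in err *.
have t0 := clock_gt0 hi.
have zE := expu hi.
have -> : expR (log_clock (k h) - log_clock (k i)) = T0 / ideal_clock (k i) * expR (u (k i) - x).
  by rewrite -zE -expRD /x; congr expR; ring.
have /andP[h1 h2] := removal_bounds h; have /andP[i1 i2] := removal_bounds i.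
have mi := m_le i; have mi0 := m0; have e0 := eps0; have e1 := eps1.
have wh := w0 h; have wi := w0 i.
have iden : w i / w h - T0 / ideal_clock (k i)
    = (w i / w h) * ((w i * ideal_clock (k i) - w h * T0) / (w i * ideal_clock (k i))).
  by field; rewrite !gt_eqF.
have iden2 : T0 / ideal_clock (k i)
    = (w i / w h) * ((w h * T0) / (w i * ideal_clock (k i))).
  by field; rewrite !gt_eqF.
have wt0 : 0 < w i * ideal_clock (k i) by rewrite mulr_gt0.
have r0 : 0 < w i / w h by rewrite divr_gt0.
have d1 : `|w i / w h - T0 / ideal_clock (k i)| <= w i / w h * (eps / 16).
  rewrite iden normrM (gtr0_norm r0) ler_wpM2l ?(ltW r0) // normrM [`|_^-1|]gtr0_norm ?invr_gt0 //.
  rewrite ler_pdivrMr //.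
  move: h1 h2 i1 i2 mi wt0; rewrite -/T0; move: (w i * _) (w h * _) => a b h1 h2 i1 i2 mi a0.
  have : eps * m <= eps * (2 * a) by rewrite ler_wpM2l // ltW.
  by rewrite ler_norml => ea; apply/andP; split; lra.
have d2 : T0 / ideal_clock (k i) <= 2 * (w i / w h).
  rewrite iden2 mulrC ler_wpM2r ?(ltW r0) // ler_pdivrMr //.
  move: h1 h2 i1 i2 mi wt0; rewrite -/T0; move: (w i * _) (w h * _) => a b h1 h2 i1 i2 mi a0.
  have : m * eps <= m * 1 by rewrite ler_wpM2l ?ltW.
  by lra.
have d3 := ler_norm_expRB1 err.
have z0 : 0 <= T0 / ideal_clock (k i) by rewrite -zE expR_ge0.
have -> : w i / w h - T0 / ideal_clock (k i) * expR (u (k i) - x)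
    = (w i / w h - T0 / ideal_clock (k i)) - T0 / ideal_clock (k i) * (expR (u (k i) - x) - 1).
  by ring.
rewrite [leRHS]mulrDr (le_trans (ler_normB _ _)) // lerD // normrM (ger0_norm z0).
apply: (le_trans (ler_wpM2l z0 d3)).
rewrite [leRHS]mulrCA mulrA ler_wpM2r //.
by rewrite (le_trans _ d3).
Qed.

Let exp_ge1 i : i \in S -> 0 <= expR (G (k i)) - 1.
Proof.
move=> iS; rewrite subr_ge0 -expR0 ler_expR /G big_nat sumr_ge0 // => r /andP[hr ri].
by have /andP[] := y_le hr ri.
Qed.

Let log_rate_ge0 r i : (r < k i)%N -> 0 <= log_rate r.
Proof.
move=> ri; rewrite /log_rate; case: ifPn => [_|].
  rewrite ln_ge0 // ler_pdivlMr // mul1r (le_trans (ltW eps1)) //.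
  have n0 : (0 < n)%N by case: (n) h => [[]|].
  have : 1 <= n%:R :> R by rewrite ler1n.
  by lra.
by rewrite leapE -leNgt => /(lt_le_trans B0)/ltW; rewrite invr_ge0.
Qed.

(** A single leap divides the estimate by [16 * n / eps], and the other rates are nonnegative. *)
Let late_estimate i : i \in S -> ~~ early i ->
  expR (log_clock (k h) - log_clock (k i)) <= eps / (16 * n%:R).
Proof.
move=> iS; rewrite negbK => /hasP[r]; rewrite mem_index_iota => /andP[hr ri] lr.
have n0 : 0 < n%:R :> R by rewrite ltr0n; case: (n) h => [[]|].
have -> : eps / (16 * n%:R) = expR (- ln (16 * n%:R / eps)).
  by rewrite expRN lnK ?invf_div // posrE divr_gt0 // mulr_gt0.
rewrite ler_expR -opprB lerN2 /log_clock sumB ?h_first //.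
have -> : ln (16 * n%:R / eps) = log_rate r by rewrite /log_rate lr.
rewrite (big_cat_nat (n := r)) ?(ltnW ri) //= [X in _ + X]big_ltn //=.
rewrite addrCA lerDl addr_ge0 // big_nat sumr_ge0 // => s /andP[_ sr].
  exact: log_rate_ge0 (ltn_trans sr ri).
exact: log_rate_ge0 sr.
Qed.

(** All late items are alive at the first leap after the removal of [h]. There the alive mass times
    the clock is at most [2 * B], while the clock has passed [T0], which is at least
    [m / (2 * w h)]. *)
Let late_mass : \sum_(i in S | ~~ early i) w i <= eps / 16 * w h.
Proof.
have [/exists_inP[i0 iS0 late0]|/exists_inPn none] := boolP [exists i in S, ~~ early i]; last first.
  rewrite big1; first exact: mulr_ge0 (divr_ge0 (ltW eps0) (ler0n _ 16)) (ltW (w0 h)).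
  move=> i /andP[iS li].
  by have := none _ iS; rewrite li.
have ex : exists r, (k h <= r)%N && leap r.
  move: late0; rewrite negbK => /hasP[r]; rewrite mem_index_iota => /andP[hr _] lr.
  by exists r; rewrite hr.
have [r /andP[hr lr] rmin] := ex_minnP ex.
have alive i : i \in S -> ~~ early i -> (r < k i)%N.
  move=> iS; rewrite negbK => /hasP[s]; rewrite mem_index_iota => /andP[hs si] ls.
  by rewrite (leq_ltn_trans _ si) // rmin // hs.
have wge0 j : 0 <= w j by exact: ltW.
apply: (@le_trans _ _ (alive_mass r)).
  rewrite [leRHS](bigID (fun i => (i \in S) && ~~ early i)) /=.
  rewrite [X in _ <= X + _](_ : _ = \sum_(i in S | ~~ early i) w i); last first.
    by apply: eq_bigl => i; case: (boolP ((i \in S) && _)) => [/andP[iS li]|];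
      rewrite ?andbF // alive.
  by rewrite lerDl sumr_ge0.
have H : [exists j, (r < k j)%N] by apply/existsP; exists i0; exact: alive.
have := count_mean H => /= dev; rewrite leapE in lr.
have mu := small_count_small_mean beta1 betaB dev lr.
have t0 := clock_gt0 (leqW hr).
have tT : T0 <= ideal_clock r.+1 by exact: ideal_clock_le (leqW hr).
have W0 : 0 <= alive_mass r by rewrite alive_mass_ge0.
have le1 : alive_mass r * T0 <= 2 * B.
  by rewrite (le_trans _ mu) // ler_wpM2l.
have mh := m_le h; rewrite -/T0 in mh.
have e0 := eps0; have wh := w0 h; have TT := T0_gt0.
rewrite -(ler_pM2r TT) (le_trans le1) //.
rewrite -[leRHS]mulrA; move: mh; rewrite -(ler_pM2l e0); move: (w h * T0) => z.
by lra.
Qed.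

Lemma clock_accuracy :
  \sum_(i in S) `|w i / w h - expR (log_clock (k h) - log_clock (k i))|
    <= eps / 4 * ((\sum_(i in S) w i) / w h).
Proof.
have wh := w0 h; have whV : 0 <= (w h)^-1 by rewrite invr_ge0 ltW.
have wge0 j : 0 <= w j by exact: ltW.
have e0 := ltW eps0.
have r1 : 1 <= VS / w h by rewrite ler_pdivlMr // mul1r.
have n0 : 0 < n%:R :> R by rewrite ltr0n; case: (n) h => [[]|].
(* Here the constant [2 ^ 19] is spent: the drift of the early items costs [24 * theta], which has
   to be at most [eps / 16]. *)
have theta_le : theta <= eps / 2 ^+ 9.
  have b0 : 0 < beta by exact: lt_le_trans beta1.
  rewrite sqrtr_le ?divr_ge0 ?exprn_ge0 // ler_pdivrMr //.
  by have := beta_m; rewrite exprMn exprVn; lra.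
have early_sum : \sum_(i in S | early i)
    `|w i / w h - expR (log_clock (k h) - log_clock (k i))| <= eps / 8 * (VS / w h).
  apply: (@le_trans _ _ (\sum_(i in S) (eps / 16 * (w i / w h)
      + 2 / w h * (w i * (expR (G (k i)) - 1))))).
    rewrite [leRHS](bigID early) /=.
    rewrite -[leLHS]addr0 lerD ?sumr_ge0 //; last first.
      by move=> i /andP[iS _]; rewrite addr_ge0 ?mulr_ge0 ?invr_ge0 ?exp_ge1.
    apply: ler_sum => i /andP[iS ei]; rewrite (le_trans (early_error iS ei)) //.
    by rewrite le_eqVlt; apply/orP; left; apply/eqP; ring.
  rewrite big_split /= -!mulr_sumr -mulr_suml -/VS.
  have := ler_wpM2l (mulr_ge0 (ler0n R 2) whV) drift_cost.
  have : 2 / w h * (12 * theta * VS) <= eps / 16 * (VS / w h).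
    rewrite (_ : 2 / w h * _ = 24 * theta * (VS / w h)); last by ring.
    by rewrite ler_wpM2r ?(le_trans _ r1) //; lra.
  by lra.
have late_sum : \sum_(i in S | ~~ early i)
    `|w i / w h - expR (log_clock (k h) - log_clock (k i))| <= eps / 8.
  apply: (@le_trans _ _ (\sum_(i in S | ~~ early i) (w i / w h + eps / (16 * n%:R)))).
    apply: ler_sum => i /andP[iS li]; rewrite (le_trans (ler_normB _ _)) // lerD //.
      by rewrite ger0_norm ?mulr_ge0.
    by rewrite ger0_norm ?expR_ge0 ?late_estimate.
  rewrite big_split /= (_ : eps / 8 = eps / 16 + eps / 16); last by field.
  rewrite lerD //; first by rewrite -mulr_suml ler_pdivrMr ?late_mass.
  rewrite sumr_const -[leLHS]mulr_natr.
  apply: (@le_trans _ _ (eps / (16 * n%:R) * n%:R)).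
    rewrite ler_wpM2l ?ler_nat ?divr_ge0 ?mulr_ge0 //.
    by rewrite -[leqRHS]card_ord max_card.
  by rewrite le_eqVlt; apply/orP; left; apply/eqP; field; rewrite gt_eqF.
rewrite (bigID early) /= (le_trans (lerD early_sum late_sum)) // -/VS.
have : eps / 8 * 1 <= eps / 8 * (VS / w h) by rewrite ler_wpM2l ?divr_ge0.
by lra.
Qed.

End Clocks.

(** * From weight ratios to the distance of the models *)

Section L1.
Variables (R : realType) (n : nat).
Implicit Types (M : mnl R n) (S : {set 'I_n}).

(** The error of the normalizing sum is at most the total error of the ratios; paying for both gives
    the factor 2. *)
Lemma l1_dist_le M M' S h (e : R) : h \in S ->
  \sum_(i in S) `|weight M i / weight M h - weight M' i / weight M' h|
    <= e / 2 * ((\sum_(i in S) weight M i) / weight M h) ->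
  l1_dist M M' S <= e.
Proof.
move=> hS; set r := fun i => weight M i / weight M h.
set q := fun i => weight M' i / weight M' h.
have S0 : S != finset.set0 by apply/finset.set0Pn; exists h.
set A := \sum_(i in S) r i; set A' := \sum_(i in S) q i.
rewrite mulr_suml -/A => D; set d := \sum_(i in S) `|_| in D.
have wh := weight_gt0 M h; have wh' := weight_gt0 M' h.
have A0 : 0 < A by rewrite /A -mulr_suml divr_gt0 // sum_weight_gt0.
have A'0 : 0 < A' by rewrite /A' -mulr_suml divr_gt0 // sum_weight_gt0.
have q0 i : 0 <= q i by rewrite divr_ge0 // ltW // weight_gt0.
have prE i : i \in S -> mnl_prob M S i = r i / A.
  move=> iS; rewrite /mnl_prob iS /r /A -mulr_suml; field.
  by rewrite !gt_eqF // sum_weight_gt0.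
have prE' i : i \in S -> mnl_prob M' S i = q i / A'.
  move=> iS; rewrite /mnl_prob iS /q /A' -mulr_suml; field.
  by rewrite !gt_eqF // sum_weight_gt0.
have dA : `|A - A'| <= d by rewrite -sumrB; exact: ler_norm_sum.
have -> : l1_dist M M' S = \sum_(i in S) `|r i / A - q i / A'|.
  rewrite /l1_dist (bigID [in S]) /= [X in _ + X]big1 ?addr0.
    by apply: eq_bigr => i iS; rewrite prE ?prE'.
  by move=> i iS; rewrite !mnl_prob_out // subr0 normr0.
apply: (@le_trans _ _ (\sum_(i in S) (`|r i - q i| / A + q i * (d / (A * A'))))).
  apply: ler_sum => i iS.
  have -> : r i / A - q i / A' = (r i - q i) / A - q i * ((A - A') / (A * A')).
    by field; rewrite !gt_eqF.
  rewrite (le_trans (ler_normB _ _)) // lerD //.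
    by rewrite normrM [`|_^-1|]gtr0_norm ?invr_gt0.
  rewrite normrM (ger0_norm (q0 i)) ler_wpM2l // normrM [`|_^-1|]gtr0_norm.
    by rewrite ler_wpM2r // invr_ge0 mulr_ge0 // ltW.
  by rewrite invr_gt0 mulr_gt0.
have dE : \sum_(i in S) `|r i - q i| = d by [].
rewrite big_split /= -!mulr_suml dE [X in _ + X * _]mulr_suml -/A'.
have -> : d / A + A' * (d / (A * A')) = 2 * d / A by field; rewrite !gt_eqF.
by rewrite ler_pdivrMr //; lra.
Qed.

Lemma d1_le M M' (e : R) : 0 <= e ->
  (forall S, S != finset.set0 -> l1_dist M M' S <= e) -> d1 M M' <= e.
Proof. by move=> e0 H; rewrite /d1; apply: bigmax_le. Qed.

End L1.

(** * The random process of the rounds *)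

Section Tails.
Variable R : realType.

Lemma expR_natr_le_expr (v : R) (k : nat) :
  -4^-1 <= v <= 4^-1 -> expR ((v - v ^+ 2) * k%:R) <= (1 + v) ^+ k.
Proof.
move=> vb; rewrite expRM_natr lerXn2r ?nnegrE ?expR_ge0 ?expR_sub_sqr_le //.
by case/andP: vb => ? ?; lra.
Qed.

(** A Chernoff bound in pointwise form: on a deviation one of the two exponential potentials reaches
    [expR b], so the right-hand side dominates the indicator and its expectation bounds the
    probability. *)
Lemma two_tails_ge1 (v a b : R) (k : nat) : 0 <= v <= 4^-1 ->
  (b <= (v - v ^+ 2) * k%:R - v * a) \/ (b <= v * a - (v + v ^+ 2) * k%:R) ->
  1 <= expR (- b) * ((1 + v) ^+ k * expR (- (v * a)) + (1 - v) ^+ k * expR (v * a)).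
Proof.
move=> /andP[v0 v1].
have h1 := @expR_natr_le_expr v k; have h2 := @expR_natr_le_expr (- v) k.
have e1 := expR_ge0 (- (v * a)); have e2 := expR_ge0 (v * a).
case=> H.
- apply: (@le_trans _ _ (expR (- b) * ((1 + v) ^+ k * expR (- (v * a))))); last first.
    rewrite ler_wpM2l ?expR_ge0 // lerDl mulr_ge0 // exprn_ge0 //; lra.
  apply: (@le_trans _ _ (expR (- b) * (expR ((v - v ^+ 2) * k%:R) * expR (- (v * a))))).
    by rewrite -!expRD -[leLHS]expR0 ler_expR; lra.
  by rewrite ler_wpM2l ?expR_ge0 // ler_wpM2r // h1 //; apply/andP; split; lra.
- apply: (@le_trans _ _ (expR (- b) * ((1 - v) ^+ k * expR (v * a)))); last first.
    rewrite ler_wpM2l ?expR_ge0 // lerDr mulr_ge0 // exprn_ge0 //; lra.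
  apply: (@le_trans _ _ (expR (- b) * (expR ((- v - (- v) ^+ 2) * k%:R) * expR (v * a)))).
    by rewrite -!expRD -[leLHS]expR0 ler_expR; lra.
  by rewrite ler_wpM2l ?expR_ge0 // ler_wpM2r // h2 //; apply/andP; split; lra.
Qed.

(** For this [v] the linear gain in the exponent is [beta / 4] and the quadratic loss at most
    [beta / 8]. The bound [beta <= nu] keeps [v] at most [1 / 4] even if the mean [mu] is small. *)
Lemma count_deviation (beta nu mu : R) (k : nat) :
    0 < nu -> 0 <= mu <= nu -> 0 <= beta <= nu ->
    Num.sqrt (beta * nu) < `|k%:R - mu| ->
  let v := Num.sqrt (beta / nu) / 4 in
  1 <= expR (- (beta / 8)) *
    ((1 + v) ^+ k * expR (- (v * mu)) + (1 - v) ^+ k * expR (v * mu)).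
Proof.
move=> nu0 /andP[mu0 munu] /andP[b0 bnu].
set s := Num.sqrt (beta / nu).
have s0 : 0 <= s := sqrtr_ge0 _.
have s2 : s ^+ 2 = beta / nu by rewrite sqr_sqrtr // divr_ge0 // ltW.
have bE : beta = s ^+ 2 * nu by rewrite s2 divfK // gt_eqF.
have s1 : s <= 1 by rewrite sqrtr_le // expr1n ler_pdivrMr // mul1r.
have -> : Num.sqrt (beta * nu) = s * nu.
  rewrite bE (_ : s ^+ 2 * nu * nu = (s * nu) ^+ 2); last by ring.
  by rewrite sqrtr_sqr ger0_norm // mulr_ge0 // ltW.
move=> dev /=; apply: two_tails_ge1; first by apply/andP; split; lra.
have s1' : s ^+ 2 <= s by rewrite expr2 ler_piMr.
have sm : s ^+ 2 * mu <= s ^+ 2 * nu by rewrite ler_wpM2l ?sqr_ge0.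
have sn : s ^+ 3 * nu <= s ^+ 2 * nu.
  by rewrite ler_wpM2r ?(ltW nu0) // exprS ler_piMl ?sqr_ge0.
have k0 : 0 <= k%:R :> R by [].
move: dev; rewrite bE ltr_normr => /orP[dev|dev]; [left|right].
- have : (s / 4 - (s / 4) ^+ 2) * (mu + s * nu) <= (s / 4 - (s / 4) ^+ 2) * k%:R.
    by rewrite ler_wpM2l //; lra.
  by lra.
- have : (s / 4 + (s / 4) ^+ 2) * k%:R <= (s / 4 + (s / 4) ^+ 2) * (mu - s * nu).
    by rewrite ler_wpM2l //; have := sqr_ge0 s; lra.
  have : 0 <= s ^+ 3 * nu by rewrite mulr_ge0 ?exprn_ge0 // ltW.
  by lra.
Qed.

(** Now the count [k] is fixed and the compensator [a] deviates: the gain is [e ^ 2 * k / 2], the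
    loss [e ^ 2 * k / 4]. *)
Lemma removal_deviation (e a : R) (k : nat) : 0 <= e <= 2^-1 ->
    e * k%:R < `|a - k%:R| ->
  1 <= expR (- (e ^+ 2 * k%:R / 4)) *
    ((1 + e / 2) ^+ k * expR (- (e / 2 * a)) + (1 - e / 2) ^+ k * expR (e / 2 * a)).
Proof.
move=> /andP[e0 e1] dev; apply: two_tails_ge1; first by apply/andP; split; lra.
move: dev; rewrite ltr_normr => /orP[dev|dev]; [right|left].
- have : e * (e * k%:R) <= e * (a - k%:R) by rewrite ler_wpM2l // ltW.
  by lra.
- have : e * (e * k%:R) <= e * (- (a - k%:R)) by rewrite ler_wpM2l // ltW.
  by lra.
Qed.

End Tails.

(** * Expectations over the picks and over the second answers *)

Section Process.
Variables (R : realType) (n : nat) (M : mnl R n) (m : nat).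
Implicit Types (s t : seq 'I_n) (S Q : {set 'I_n}) (F : seq 'I_n -> R).

(* [s] lists the picks of the past rounds, [t] those of the coming rounds;
   [Epick] is the expectation over the picks, [Emeasure] the one over the second
   answers when the picks are given, and [Erounds] the joint one. *)
Definition alive s : {set 'I_n} := [set j | (count_mem j s < m)%N]%SET.
Definition mass S := \sum_(j in S) weight M j.

Lemma in_alive s j : (j \in alive s) = (count_mem j s < m)%N.
Proof. by rewrite finset.inE. Qed.

Fixpoint Epick N s F : R :=
  if N is N'.+1 then
    \sum_a mnl_prob M (alive s) a * Epick N' (rcons s a) (fun t => F (a :: t))
  else F [::].

Fixpoint Emeasure s t F : R :=
  if t is a :: t' then
    \sum_b mnl_prob M (alive s) b * Emeasure (rcons s a) t' (fun u => F (b :: u))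
  else F [::].

Fixpoint Erounds N s (F : seq 'I_n -> seq 'I_n -> R) : R :=
  if N is N'.+1 then
    \sum_a mnl_prob M (alive s) a * \sum_b mnl_prob M (alive s) b *
      Erounds N' (rcons s a) (fun t u => F (a :: t) (b :: u))
  else F [::] [::].

Lemma eq_Epick N s F F' : F =1 F' -> Epick N s F = Epick N s F'.
Proof.
elim: N s F F' => [|N IH] s F F' FF' /=; first exact: FF'.
by apply: eq_bigr => a _; congr (_ * _); apply: IH => t; exact: FF'.
Qed.

Lemma Epick_sum N s (I : finType) (c : I -> R) (F : I -> seq 'I_n -> R) :
  \sum_i c i * Epick N s (F i) = Epick N s (fun t => \sum_i c i * F i t).
Proof.
elim: N s F => [|N IH] s F //=.
under eq_bigr do rewrite mulr_sumr; rewrite exchange_big /=.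
apply: eq_bigr => a _; rewrite -IH mulr_sumr; apply: eq_bigr => i _.
by rewrite mulrCA.
Qed.

(** The second answers do not influence any slate, so all the picks can be drawn before them. *)
Lemma Erounds_split N s (F : seq 'I_n -> seq 'I_n -> R) :
  Erounds N s F = Epick N s (fun t => Emeasure s t (F t)).
Proof.
elim: N s F => [|N IH] s F //=; apply: eq_bigr => a _; congr (_ * _).
under eq_bigr do rewrite IH.
by rewrite Epick_sum.
Qed.

Lemma Epick_le N s F F' : (forall t, F t <= F' t) -> Epick N s F <= Epick N s F'.
Proof.
elim: N s F F' => [|N IH] s F F' FF' /=; first exact: FF'.
by apply: ler_sum => a _; rewrite ler_wpM2l ?mnl_prob_ge0 // IH.
Qed.

Lemma Emeasure_le s t F F' : (forall u, F u <= F' u) -> Emeasure s t F <= Emeasure s t F'.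
Proof.
elim: t s F F' => [|a t IH] s F F' FF' /=; first exact: FF'.
by apply: ler_sum => b _; rewrite ler_wpM2l ?mnl_prob_ge0 // IH.
Qed.

Lemma Emeasure_ge0 s t F : (forall u, 0 <= F u) -> 0 <= Emeasure s t F.
Proof.
elim: t s F => [|a t IH] s F F0 /=; first exact: F0.
by apply: sumr_ge0 => b _; rewrite mulr_ge0 ?mnl_prob_ge0 // IH.
Qed.

Lemma sum_mnl_prob_le S (F : 'I_n -> R) (c : R) :
  0 <= c -> (forall j, F j <= c) -> \sum_j mnl_prob M S j * F j <= c.
Proof.
move=> c0 Fc; apply: (@le_trans _ _ (\sum_j mnl_prob M S j * c)).
  by apply: ler_sum => j _; rewrite ler_wpM2l ?mnl_prob_ge0.
by rewrite -mulr_suml ler_piMl // sum_mnl_prob_le1.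
Qed.

(** Equality fails once no item is alive: the slate is then empty and all its probabilities are
    0. *)
Lemma Epick_const N s (c : R) : 0 <= c -> Epick N s (fun=> c) <= c.
Proof.
by move=> c0; elim: N s => [|N IH] s //=; exact: sum_mnl_prob_le.
Qed.

Lemma Emeasure_const s t (c : R) : 0 <= c -> Emeasure s t (fun=> c) <= c.
Proof.
by move=> c0; elim: t s => [|a t IH] s //=; exact: sum_mnl_prob_le.
Qed.

Lemma EmeasureZ s t (c : R) F : Emeasure s t (fun u => c * F u) = c * Emeasure s t F.
Proof.
elim: t s F => [|a t IH] s F //=; rewrite mulr_sumr; apply: eq_bigr => b _.
by rewrite IH mulrCA.
Qed.

Lemma EmeasureD s t F F' :
  Emeasure s t (fun u => F u + F' u) = Emeasure s t F + Emeasure s t F'.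
Proof.
elim: t s F F' => [|a t IH] s F F' //=; rewrite -big_split; apply: eq_bigr => b _ /=.
by rewrite IH mulrDr.
Qed.

Lemma EpickZ N s (c : R) F : Epick N s (fun t => c * F t) = c * Epick N s F.
Proof.
elim: N s F => [|N IH] s F //=; rewrite mulr_sumr; apply: eq_bigr => a _.
by rewrite IH mulrCA.
Qed.

Lemma EpickD N s F F' : Epick N s (fun t => F t + F' t) = Epick N s F + Epick N s F'.
Proof.
elim: N s F F' => [|N IH] s F F' //=; rewrite -big_split; apply: eq_bigr => a _ /=.
by rewrite IH mulrDr.
Qed.

Lemma Erounds_le N s (F F' : seq 'I_n -> seq 'I_n -> R) :
  (forall t u, F t u <= F' t u) -> Erounds N s F <= Erounds N s F'.
Proof.
by move=> FF'; rewrite !Erounds_split; apply: Epick_le => t; apply: Emeasure_le.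
Qed.

Lemma EroundsD N s (F F' : seq 'I_n -> seq 'I_n -> R) :
  Erounds N s (fun t u => F t u + F' t u) = Erounds N s F + Erounds N s F'.
Proof.
rewrite !Erounds_split -EpickD; apply: eq_Epick => t.
by rewrite -EmeasureD.
Qed.

Lemma Erounds0 N s : Erounds N s (fun _ _ => 0) = 0.
Proof.
elim: N s => [|N IH] s //=; rewrite big1 // => a _; rewrite big1 ?mulr0 // => b _.
by rewrite IH mulr0.
Qed.

Lemma Erounds_sum N s (I : Type) (r : seq I) (F : I -> seq 'I_n -> seq 'I_n -> R) :
  Erounds N s (fun t u => \sum_(i <- r) F i t u) = \sum_(i <- r) Erounds N s (F i).
Proof.
elim: r => [|i r IH]; last rewrite big_cons -IH -EroundsD.
  rewrite big_nil -[RHS](Erounds0 N s); congr Erounds; apply/funext => t.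
  by apply/funext => u; rewrite big_nil.
congr Erounds; apply/funext => t; apply/funext => u; exact: big_cons.
Qed.

(* Both [Epick] and [Emeasure] observe hits of a set [Q] of slate items; the
   factor [1 + v] per hit has conditional mean at most
   [exp (v * mass Q / mass S)], which makes the products supermartingales. *)
Lemma hit_factor_le S Q (v : R) : -1 <= v -> Q \subset S ->
  \sum_b mnl_prob M S b * (1 + v) ^+ (b \in Q) <= expR (v * (mass Q / mass S)).
Proof.
move=> v1 QS; have [->|S0] := eqVneq S finset.set0.
  rewrite big1 ?expR_ge0 // => b _.
  by rewrite mnl_prob_out ?mul0r // finset.inE.
apply: le_trans (expR_ge1Dx _).
rewrite -[X in _ <= X + _](sum_mnl_prob M S0) -(sum_mnl_prob_subset M QS) mulr_sumr.
rewrite [X in _ <= _ + X]big_mkcond -big_split /=; apply: ler_sum => b _.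
case: (b \in Q) => /=; rewrite ?expr1 ?expr0 ?mulr1 ?addr0 //.
by rewrite mulrDr mulr1 [v * _]mulrC.
Qed.

(** Given the picks, the second answers are independent, and each of the first [p] lies in [Q] with
    probability [mass Q] over the mass of its slate; the bounds of [hit_factor_le] multiply. *)
Lemma Emeasure_hits s t p Q (v : R) : -1 <= v -> (p <= size t)%N ->
  (forall i, (i < p)%N -> Q \subset alive (s ++ take i t)) ->
  Emeasure s t (fun u => (1 + v) ^+ count (mem Q) (take p u))
    <= expR (v * (mass Q * \sum_(i < p) (mass (alive (s ++ take i t)))^-1)).
Proof.
move=> v1; have v0 : 0 <= 1 + v by lra.
elim: t s p => [|a t IH] s [|p] // pt QS.
- by rewrite /= big_ord0 mulr0 mulr0 expR0.
- by rewrite big_ord0 !mulr0 expR0 (le_trans _ (Emeasure_const s (a :: t) ler01)).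
rewrite /= big_ord_recl /= cats0 mulrDr mulrDr expRD.
have QS0 := QS 0%N isT; rewrite /= cats0 in QS0.
have QS' i : (i < p)%N -> Q \subset alive (rcons s a ++ take i t).
  by move=> ip; have := QS i.+1 ip; rewrite /= cat_rcons.
have {IH} := IH (rcons s a) p pt QS'.
under [X in _ <= expR (v * (_ * X))]eq_bigr do rewrite cat_rcons.
move: (expR _) => e; set E := Emeasure _ _ _ => Ee.
have E0 : 0 <= E by apply: Emeasure_ge0 => u; rewrite exprn_ge0.
apply: (@le_trans _ _ ((\sum_b mnl_prob M (alive s) b * (1 + v) ^+ (b \in Q)) * E)).
  rewrite mulr_suml; apply: ler_sum => b _; rewrite -mulrA ler_wpM2l ?mnl_prob_ge0 // /E -EmeasureZ.
  by apply: Emeasure_le => u; rewrite -exprD.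
rewrite ler_pM ?hit_factor_le // sumr_ge0 // => b _.
by rewrite mulr_ge0 ?mnl_prob_ge0 ?exprn_ge0.
Qed.

(** The ideal clock stopped at the removal of [j]. *)
Definition pick_clock s j :=
  \sum_(r < size s | j \in alive (take r s)) (mass (alive (take r s)))^-1.

Lemma pick_clock_rcons s a j :
  pick_clock (rcons s a) j
    = pick_clock s j + (if j \in alive s then (mass (alive s))^-1 else 0).
Proof.
rewrite /pick_clock size_rcons big_mkcond big_ord_recr /=.
rewrite -cats1 take_size_cat // [in RHS]big_mkcond; congr (_ + _).
by apply: eq_bigr => r _; rewrite takel_cat // ltnW.
Qed.

Definition pick_potential (v : R) j s :=
  (1 + v) ^+ count_mem j s * expR (- (v * (weight M j * pick_clock s j))).

(** While [j] is alive, [hit_factor_le] for the set of [j] alone is compensated by the advance of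
    the clock. After its removal [j] cannot be picked and its clock stands still. *)
Lemma Epick_potential N s (v : R) j : -1 <= v ->
  Epick N s (fun t => pick_potential v j (s ++ t)) <= pick_potential v j s.
Proof.
move=> v1; have v0 : 0 <= 1 + v by lra.
have pot0 s' : 0 <= pick_potential v j s' by rewrite mulr_ge0 ?exprn_ge0 ?expR_ge0.
elim: N s => [|N IH] s /=; first by rewrite cats0.
apply: (@le_trans _ _ (\sum_a mnl_prob M (alive s) a * pick_potential v j (rcons s a))).
  apply: ler_sum => a _; rewrite ler_wpM2l ?mnl_prob_ge0 //.
  by under eq_Epick do rewrite -cat_rcons.
have [js|js] := boolP (j \in alive s); last first.
  apply: (@le_trans _ _ (\sum_a mnl_prob M (alive s) a * pick_potential v j s)).
    apply: ler_sum => a _; have [->|aj] := eqVneq a j.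
      by rewrite mnl_prob_out // !mul0r.
    rewrite /pick_potential pick_clock_rcons (negbTE js) addr0.
    by rewrite -cats1 count_cat /= (negbTE aj) !addn0.
  by rewrite -mulr_suml ler_piMl // sum_mnl_prob_le1.
apply: (@le_trans _ _ ((\sum_a mnl_prob M (alive s) a * (1 + v) ^+ (a \in [set j]%SET))
    * expR (- (v * (weight M j / mass (alive s)))) * pick_potential v j s)).
  rewrite !mulr_suml; apply: ler_sum => a _.
  rewrite -!mulrA ler_wpM2l ?mnl_prob_ge0 // /pick_potential pick_clock_rcons js.
  rewrite -cats1 count_cat /= addn0 exprD finset.inE !mulrDr opprD expRD.
  rewrite le_eqVlt; apply/orP; left; apply/eqP; ring.
rewrite ler_piMl // -(@ler_pM2r _ (expR (v * (weight M j / mass (alive s))))) ?expR_gt0 //.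
rewrite -mulrA -expRD addNr expR0 mul1r mulr1.
rewrite (le_trans (hit_factor_le _ _)) ?finset.sub1set //.
by rewrite /mass finset.big_set1.
Qed.

Lemma alive_take_subset r p t : (r <= p)%N -> alive (take p t) \subset alive (take r t).
Proof.
move=> rp; apply/fintype.subsetP => j; rewrite !in_alive; apply: leq_ltn_trans.
by rewrite -(take_takel t rp) -{2}(cat_take_drop r (take p t)) count_cat leq_addr.
Qed.

(** Since alive sets only shrink, this number is also the index of the first slate without [j], or
    the length of [t] if there is none. *)
Definition removal_round t j := (\sum_(r < size t) (j \in alive (take r t)))%N.

Lemma removal_round_le t j : (removal_round t j <= size t)%N.
Proof.
apply: (@leq_trans (\sum_(r < size t) 1)%N); last by rewrite sum1_card card_ord.
by apply: leq_sum => r _; exact: leq_b1.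
Qed.

Lemma ltn_removal_round t r j : (r < size t)%N ->
  (r < removal_round t j)%N = (j \in alive (take r t)).
Proof.
move=> rt; rewrite /removal_round; have [jr|jr] := boolP (j \in alive (take r t)).
- rewrite (bigID (fun i : 'I_(size t) => (i < r.+1)%N)) /= ltn_addr //.
  rewrite -(big_ord_widen (size t) (fun i => (j \in alive (take i t)) : nat)) //.
  rewrite (eq_bigr (fun=> 1%N)) ?sum1_card ?card_ord // => i _.
  by rewrite (fintype.subsetP (alive_take_subset t (leq_ord i)) _ jr).
- apply/negbTE; rewrite -leqNgt (bigID (fun i : 'I_(size t) => (i < r)%N)) /=.
  rewrite [X in (_ + X)%N]big1 ?addn0; last first.
    move=> i; rewrite -leqNgt => ri; apply/eqP; rewrite eqb0; apply: contra jr.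
    exact: (fintype.subsetP (alive_take_subset t ri)).
  rewrite -(big_ord_widen (size t) (fun i => (j \in alive (take i t)) : nat) (ltnW rt)).
  apply: (@leq_trans (\sum_(i < r) 1)%N); last by rewrite sum1_card card_ord.
  by apply: leq_sum => i _; exact: leq_b1.
Qed.

Lemma alive_mass_alive t r : (r < size t)%N ->
  alive_mass (weight M) (removal_round t) r = mass (alive (take r t)).
Proof. by move=> rt; apply: eq_bigl => j; rewrite ltn_removal_round. Qed.

Lemma ideal_clock_alive t r : (r <= size t)%N ->
  ideal_clock (weight M) (removal_round t) r
    = \sum_(i < r) (mass (alive (take i t)))^-1.
Proof.
by move=> rt; apply: eq_bigr => i _; rewrite alive_mass_alive // (leq_trans _ rt).
Qed.

Lemma ideal_clock_removal t j :
  ideal_clock (weight M) (removal_round t) (removal_round t j) = pick_clock t j.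
Proof.
rewrite ideal_clock_alive ?removal_round_le // /pick_clock.
rewrite (big_ord_widen (size t) (fun i => (mass (alive (take i t)))^-1)) ?removal_round_le //.
by apply: eq_bigl => i; rewrite ltn_removal_round.
Qed.

(** The answer of round [r] itself is counted, so the mean involves the clock after that round. The
    current set lies in all the earlier slates, as [Emeasure_hits] demands. *)
Definition hits t u r := count (mem (alive (take r t))) (take r.+1 u).
Definition mean_hits t r :=
  mass (alive (take r t)) * \sum_(i < r.+1) (mass (alive (take i t)))^-1.

Lemma mean_hits_ge0 t r : 0 <= mean_hits t r.
Proof.
by rewrite mulr_ge0 ?sum_weight_ge0 // sumr_ge0 // => i _; rewrite invr_ge0 sum_weight_ge0.
Qed.

Lemma Emeasure_hits_deviation t r (beta b : R) : 0 <= beta <= b -> 0 < b -> (r < size t)%N ->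
  Emeasure [::] t (fun u => (Num.sqrt (beta * Num.max (mean_hits t r) b)
      < `|(hits t u r)%:R - mean_hits t r|)%R%:R)
    <= 2 * expR (- (beta / 8)).
Proof.
move=> /andP[beta0 betab] b0 rt; set mu := mean_hits t r; set nu := Num.max mu b.
have mu0 : 0 <= mu := mean_hits_ge0 t r.
have nu0 : 0 < nu by rewrite lt_max b0 orbT.
have munu : 0 <= mu <= nu by rewrite mu0 le_max lexx.
have betanu : 0 <= beta <= nu by rewrite beta0 le_max betab orbT.
set v := Num.sqrt (beta / nu) / 4.
have v01 : 0 <= v <= 4^-1.
  rewrite /v divr_ge0 ?sqrtr_ge0 //= ler_piMl ?invr_ge0 // sqrtr_le // expr1n.
  by rewrite ler_pdivrMr // mul1r; case/andP: betanu.
have hit (x : R) : -1 <= x ->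
    Emeasure [::] t (fun u => (1 + x) ^+ hits t u r) <= expR (x * mu).
  by move=> x1; apply: Emeasure_hits => // i; rewrite ltnS; exact: alive_take_subset.
apply: (@le_trans _ _ (Emeasure [::] t (fun u =>
    (expR (- (beta / 8)) * expR (- (v * mu))) * (1 + v) ^+ hits t u r
    + (expR (- (beta / 8)) * expR (v * mu)) * (1 - v) ^+ hits t u r))).
  apply: Emeasure_le => u; case: ltP => [dev|_].
    have := count_deviation nu0 munu betanu dev; rewrite -/v => /le_trans; apply.
    by rewrite le_eqVlt; apply/orP; left; apply/eqP; ring.
  have [/andP[v0 v1] e0] := (v01, @expR_ge0 R).
  by rewrite addr_ge0 ?mulr_ge0 ?exprn_ge0 //; lra.
rewrite EmeasureD !EmeasureZ mulr2n mulrDl mul1r.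
have [v0 v1] := andP v01.
have e0 : 0 <= expR (- (beta / 8)) by exact: expR_ge0.
rewrite lerD // -[leRHS]mulr1 -mulrA ler_wpM2l //.
- apply: (le_trans (ler_wpM2l (expR_ge0 _) (hit v _))); first by lra.
  by rewrite -expRD addNr expR0.
- apply: (le_trans (ler_wpM2l (expR_ge0 _) (hit (- v) _))); first by lra.
  by rewrite mulNr -expRD subrr expR0.
Qed.

(** No stopping time is needed: the count and the clock of [j] freeze at its removal, so the
    deviation there can be read off at the end. *)
Lemma Epick_removal_deviation N j (e : R) : 0 <= e <= 2^-1 ->
  Epick N [::] (fun t => ((count_mem j t == m) &&
      (e * m%:R < `|weight M j * pick_clock t j - m%:R|)%R)%:R)
    <= 2 * expR (- (e ^+ 2 * m%:R / 4)).
Proof.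
move=> e01; have [e0 e1] := andP e01; set c := expR (- _).
have c0 : 0 <= c by exact: expR_ge0.
apply: (@le_trans _ _ (Epick N [::] (fun t =>
    c * pick_potential (e / 2) j ([::] ++ t) + c * pick_potential (- (e / 2)) j ([::] ++ t)))).
  apply: Epick_le => t; rewrite /= /pick_potential; case: andP => [[/eqP -> dev]|_].
    have := removal_deviation e01 dev; rewrite -/c => /le_trans; apply.
    by rewrite mulNr opprK mulrDr.
  by rewrite addr_ge0 // !mulr_ge0 ?exprn_ge0 ?expR_ge0 //; lra.
rewrite EpickD !EpickZ [leRHS](_ : _ = c + c); last by ring.
have pot (v : R) : -1 <= v -> Epick N [::] (fun t => pick_potential v j ([::] ++ t)) <= 1.
  move=> v1; rewrite (le_trans (Epick_potential N [::] j v1)) // /pick_potential.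
  by rewrite /pick_clock big_ord0 /= mulr0 mulr0 oppr0 expR0 mulr1.
by apply: lerD; apply: ler_piMr => //; apply: pot; lra.
Qed.

End Process.

(** * Union bound over the failure events *)

Section Failure.
Variables (R : realType) (n : nat) (M : mnl R n) (m : nat) (eps beta : R).
Implicit Types (t u : seq 'I_n).
Hypothesis m0 : (0 < m)%N.
Hypothesis eps01 : 0 < eps < 1.
Hypothesis beta1 : 1 <= beta.
Hypothesis beta_m : 2 ^+ 19 * beta <= eps ^+ 2 * m%:R.

Definition final_log t u (j : 'I_n) : R :=
  - log_clock n (fun r => (hits m t u r)%:R) eps m%:R (removal_round m t j).
Definition all_removed t := [forall j : 'I_n, count_mem j t == m].
Definition accurate t u := d1 M (mnl_of_logs (final_log t u)) <= eps.

Let B := eps * m%:R / 64.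
Let bad_removal j t := (count_mem j t == m) &&
  (eps / 64 * m%:R < `|weight M j * pick_clock M m t j - m%:R|).
Let bad_hits r t u := (r < size t)%N &&
  (Num.sqrt (beta * Num.max (mean_hits M m t r) (B / 2))
    < `|(hits m t u r)%:R - mean_hits M m t r|).

Let B_bounds : 0 <= beta <= B / 2 /\ 0 < B / 2.
Proof.
have [e0 e1] := andP eps01; have b1 := beta1; have bm := beta_m.
have mr : 0 < m%:R :> R by rewrite ltr0n.
have em : 0 < eps * m%:R by rewrite mulr_gt0.
have : eps * (eps * m%:R) <= 1 * (eps * m%:R) by rewrite ler_wpM2r // ltW.
by rewrite /B => h; split; [apply/andP; split|]; lra.
Qed.

Lemma accurate_rounds t u : all_removed t ->
  (forall j, ~~ bad_removal j t) -> (forall r, ~~ bad_hits r t u) -> accurate t u.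
Proof.
move=> /forallP rem good1 good2; have [e0 e1] := andP eps01.
apply: d1_le => [|S S0]; first exact: ltW.
have /finset.set0Pn[i0 i0S] := S0.
have [h hS hmin] := arg_minnP (removal_round m t) i0S.
apply: (l1_dist_le hS) => /=.
have t0 : (0 < size t)%N.
  rewrite (leq_trans m0) // -(eqP (rem h)); exact: count_size.
have k0 j : (0 < removal_round m t j)%N by rewrite ltn_removal_round // take0 in_alive.
have d1' j : `|weight M j * ideal_clock (weight M) (removal_round m t) (removal_round m t j) - m%:R|
    <= eps / 64 * m%:R.
  by rewrite ideal_clock_removal; have := good1 j; rewrite /bad_removal rem -leNgt.
have d2 r : [exists j, (r < removal_round m t j)%N] ->
    let mu := alive_mass (weight M) (removal_round m t) r
      * ideal_clock (weight M) (removal_round m t) r.+1 in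
    `|(hits m t u r)%:R - mu| <= Num.sqrt (beta * Num.max mu (eps * m%:R / 64 / 2)).
  move=> /existsP[j rj] /=; have rt : (r < size t)%N.
    by rewrite (leq_trans rj) // removal_round_le.
  rewrite alive_mass_alive // ideal_clock_alive //.
  by have := good2 r; rewrite /bad_hits rt -leNgt.
have mr : 0 < m%:R :> R by rewrite ltr0n.
have := clock_accuracy (weight_gt0 M) k0 eps01 mr beta1 beta_m d1' d2 hS hmin.
have whS : 0 <= (\sum_(i in S) weight M i) / weight M h.
  by rewrite divr_ge0 ?sum_weight_ge0 // ltW // weight_gt0.
move=> acc; apply: le_trans (_ : eps / 4 * ((\sum_(i in S) weight M i) / weight M h) <= _).
  apply: le_trans acc; rewrite le_eqVlt; apply/orP; left; apply/eqP.
  apply: eq_bigr => i _; rewrite /final_log -expRB.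
  by congr (`|_ - expR _|); ring.
by rewrite ler_wpM2r //; lra.
Qed.

Lemma sum_count_mem t : (\sum_j count_mem j t)%N = size t.
Proof.
elim: t => [|a t IH] /=; first by rewrite big1.
rewrite big_split /= IH (bigD1 a) //= eqxx big1 // => j ja.
by rewrite eq_sym (negbTE ja).
Qed.

Lemma size_all_removed t : all_removed t -> size t = (n * m)%N.
Proof.
move=> /forallP rem; rewrite -sum_count_mem (eq_bigr (fun=> m)).
  by rewrite sum_nat_const card_ord.
by move=> j _; exact/eqP.
Qed.

(** The union is over [n] removals and [n * m] rounds, because [all_removed] forces the number of
    rounds to be [n * m]. *)
Lemma Erounds_failure N :
  Erounds M m N [::] (fun t u => (all_removed t && ~~ accurate t u)%:R)
    <= n%:R * (2 * expR (- ((eps / 64) ^+ 2 * m%:R / 4)))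
       + (n * m)%:R * (2 * expR (- (beta / 8))).
Proof.
apply: (@le_trans _ _ (Erounds M m N [::] (fun t u =>
    \sum_j (bad_removal j t)%:R + \sum_(r < n * m) (bad_hits r t u)%:R))).
  apply: Erounds_le => t u; set s1 := \sum_j _; set s2 := \sum_(r < _) _.
  have s10 : 0 <= s1 by apply: sumr_ge0.
  have s20 : 0 <= s2 by apply: sumr_ge0.
  have le1 : s1 <= s1 + s2 by rewrite lerDl.
  have le2 : s2 <= s1 + s2 by rewrite lerDr.
  case: andP => [[rem nacc]|_]; last by rewrite addr_ge0.
  have [/existsP[j bj]|/existsPn good1] := boolP [exists j, bad_removal j t].
    by rewrite (le_trans _ le1) // /s1 (bigD1 j) //= bj lerDl sumr_ge0.
  have [/existsP[r br]|/existsPn good2] := boolP [exists r : 'I_(n * m), bad_hits r t u].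
    by rewrite (le_trans _ le2) // /s2 (bigD1 r) //= br lerDl sumr_ge0.
  case/negP: nacc; apply: accurate_rounds => // r; rewrite /bad_hits size_all_removed //.
  case: ltnP => // rt; have := good2 (Ordinal rt).
  by rewrite /bad_hits /= size_all_removed // rt.
rewrite EroundsD !Erounds_sum; apply: lerD.
- rewrite mulr_natl -[X in _ *+ X]card_ord -sumr_const; apply: ler_sum => j _.
  rewrite Erounds_split (le_trans _ (Epick_removal_deviation M m N j _)) //; last first.
    by have [e0 e1] := andP eps01; apply/andP; split; lra.
  by apply: Epick_le => t; rewrite Emeasure_const.
- rewrite mulr_natl -[X in _ *+ X]card_ord -sumr_const; apply: ler_sum => r _.
  have c0 : 0 <= 2 * expR (- (beta / 8)) by rewrite mulr_ge0 ?expR_ge0.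
  rewrite Erounds_split (le_trans _ (Epick_const M m N [::] c0)) //.
  apply: Epick_le => t; rewrite /bad_hits; case: (boolP (r < size t)%N) => rt /=.
    by have [b01 b0] := B_bounds; exact: Emeasure_hits_deviation.
  by rewrite (le_trans (Emeasure_const _ _ _ _ _)).
Qed.

End Failure.

Lemma Erounds_failure_le (R : realType) n (M : mnl R n) m (eps delta : R) N :
    (0 < n)%N -> (0 < m)%N -> 0 < eps < 1 -> 0 < delta < 1 ->
    2 ^+ 22 * ln (4 * n%:R * m%:R / delta) <= eps ^+ 2 * m%:R ->
  Erounds M m N [::] (fun t u => (all_removed m t && ~~ accurate M m eps t u)%:R) <= delta.
Proof.
move=> n0 m0 eps01 /andP[d0 d1]; set L := ln _ => Lm.
have [e0 e1] := andP eps01.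
have nr : 1 <= n%:R :> R by rewrite ler1n.
have mr : 1 <= m%:R :> R by rewrite ler1n.
have x0 : 0 < 4 * n%:R * m%:R / delta by rewrite divr_gt0 // !mulr_gt0 // ltr0n.
have x4 : 4 <= 4 * n%:R * m%:R / delta.
  rewrite ler_pdivlMr // -mulrA ler_pM2l // (le_trans (ltW d1)) //.
  by rewrite mulr_ege1.
have L8 : 8^-1 <= L.
  rewrite -[leLHS]expRK ler_ln ?posrE ?expR_gt0 // (le_trans _ x4) //.
  apply: (@le_trans _ _ (expR (4^-1 - 4^-1 ^+ 2))); first by rewrite ler_expR; lra.
  have le4 := @expR_sub_sqr_le R 4^-1.
  by apply: le_trans (le4 _) _; [rewrite lexx andbT|]; lra.
(* This makes [expR (- (beta / 8))] equal to [delta / (4 * n * m)], so that the removals and the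
   rounds fail with probability at most [delta / 2] each; [2 ^ 22] is [8 * 2 ^ 19]. *)
set beta := 8 * L.
have beta1 : 1 <= beta by rewrite /beta; lra.
have beta_m : 2 ^+ 19 * beta <= eps ^+ 2 * m%:R.
  by rewrite /beta; apply: le_trans Lm; lra.
apply: (le_trans (Erounds_failure M m0 eps01 beta1 beta_m N)).
have tail : expR (- (beta / 8)) = delta / (4 * n%:R * m%:R).
  rewrite /beta [8 * L]mulrC mulfK ?pnatr_eq0 // expRN lnK ?invf_div //.
have head : expR (- ((eps / 64) ^+ 2 * m%:R / 4)) <= delta / (4 * n%:R * m%:R).
  rewrite -tail ler_expR lerN2; move: beta_m; rewrite expr_div_n /beta.
  have -> : eps ^+ 2 / 64 ^+ 2 * m%:R / 4 = eps ^+ 2 * m%:R / 2 ^+ 14.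
    by field.
  by rewrite ler_pdivlMr ?exprn_gt0 //; lra.
rewrite tail natrM.
have n0' : n%:R != 0 :> R by rewrite pnatr_eq0 -lt0n.
have m0' : m%:R != 0 :> R by rewrite pnatr_eq0 -lt0n.
have h1 : n%:R * (2 * expR (- ((eps / 64) ^+ 2 * m%:R / 4))) <= delta / 2.
  apply: (@le_trans _ _ (n%:R * (2 * (delta / (4 * n%:R * m%:R))))).
    by rewrite ler_wpM2l // ler_wpM2l.
  have -> : n%:R * (2 * (delta / (4 * n%:R * m%:R))) = delta / 2 * m%:R^-1.
    by field; rewrite n0' m0'.
  by rewrite ler_piMr ?divr_ge0 ?(ltW d0) // invf_le1 // ltr0n.
have -> : n%:R * m%:R * (2 * (delta / (4 * n%:R * m%:R))) = delta / 2.
  by field; rewrite n0' m0'.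
by lra.
Qed.

(** * The program *)

Section Execution.
Variables (R : realType) (n : nat) (M : mnl R n).
Variables (E : config R -> bool) (k : seq cmd) (nm : nat -> nat -> nat)
  (rm : nat -> nat -> R) (q t : nat) (phi : R).

Lemma fails_within_skip :
  fails_within M E (Config k nm rm q t.+1) phi ->
  fails_within M E (Config (Skip :: k) nm rm q t) phi.
Proof. exact: fails_within_det. Qed.

Lemma fails_within_nset a i e :
  fails_within M E (Config k (upd nm a (neval nm i) (neval nm e)) rm q t.+1) phi ->
  fails_within M E (Config (NSet a i e :: k) nm rm q t) phi.
Proof. exact: fails_within_det. Qed.

Lemma fails_within_rset a i e :
  fails_within M E (Config k nm (upd rm a (neval nm i) (reval nm rm e)) q t.+1) phi ->
  fails_within M E (Config (RSet a i e :: k) nm rm q t) phi.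
Proof. exact: fails_within_det. Qed.

Lemma fails_within_seq c1 c2 :
  fails_within M E (Config (c1 :: c2 :: k) nm rm q t.+1) phi ->
  fails_within M E (Config (Seq c1 c2 :: k) nm rm q t) phi.
Proof. exact: fails_within_det. Qed.

Lemma fails_within_if b c1 c2 :
  fails_within M E (Config ((if beval nm rm b then c1 else c2) :: k) nm rm q t.+1) phi ->
  fails_within M E (Config (If b c1 c2 :: k) nm rm q t) phi.
Proof. exact: fails_within_det. Qed.

Lemma fails_within_while b c :
  fails_within M E
    (Config (if beval nm rm b then c :: While b c :: k else k) nm rm q t.+1) phi ->
  fails_within M E (Config (While b c :: k) nm rm q t) phi.
Proof. exact: fails_within_det. Qed.

End Execution.

(* Array 6 is never written, so that the slate is {item 0}.  These queries pay
   for the running time of the initialization. *)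
Definition dummy_query : cmd := Query 5 (NConst 0) 6 (NConst 1).

Definition cell a := NGet a (NConst 0).

Definition incr a i := NSet a i (NAdd (NGet a i) (NConst 1)).

Definition epsilon := RGet 0 (NConst 0).

(** The constant enters as a cube, so that [2 ^ 33] arises from the much smaller [2 ^ 11]. *)
Definition below_target (k0 : nat) : bexp :=
  BRLt (RNat (cell 7))
    (RDiv (RMul (RMul (RNat (NConst k0)) (RMul (RNat (NConst k0)) (RNat (NConst k0))))
             (RLn (RDiv (RNat (cell 0)) (RGet 0 (NConst 1)))))
          (RMul epsilon (RMul epsilon epsilon))).

(** Reals cannot be converted to integers, so the target is rounded up by counting, at the price of
    one dummy query per unit. *)
Definition set_target (k0 : nat) : cmd :=
  While (below_target k0) (Seq (incr 7 (NConst 0)) dummy_query).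

Definition fill_list : cmd :=
  While (BNLt (cell 8) (cell 0))
    (Seq (NSet 1 (cell 8) (cell 8))
    (Seq (NSet 2 (cell 8) (cell 8))
    (Seq (incr 8 (NConst 0)) dummy_query))).

Definition advance_clock : cmd :=
  If (BRLt (RMul (RNat (NConst 64)) (RNat (cell 11))) (RMul epsilon (RNat (cell 7))))
    (RSet 2 (NConst 0) (RAdd (RGet 2 (NConst 0))
       (RLn (RDiv (RMul (RNat (NConst 16)) (RNat (cell 0))) epsilon))))
    (RSet 2 (NConst 0) (RAdd (RGet 2 (NConst 0)) (RDiv (RNat (NConst 1)) (RNat (cell 11))))).

(** Constant-time deletion: the last listed item takes the place of the removed one. Subtracting the
    second answers equal to the removed item keeps cell 0 of array 11 the count for the new set,
    without revisiting past rounds. *)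
Definition remove_item : cmd :=
  Seq (RSet 1 (cell 9) (RSub (RNat (NConst 0)) (RGet 2 (NConst 0))))
  (Seq (NSet 11 (NConst 0) (NSub (cell 11) (NGet 4 (cell 9))))
  (Seq (NSet 8 (NConst 0) (NSub (cell 8) (NConst 1)))
  (Seq (NSet 1 (NGet 2 (cell 9)) (NGet 1 (cell 8)))
       (NSet 2 (NGet 1 (cell 8)) (NGet 2 (cell 9)))))).

Definition remove_if_done : cmd :=
  If (BNLt (NGet 3 (cell 9)) (cell 7)) Skip remove_item.

Definition round : cmd :=
  Seq (Query 9 (NConst 0) 1 (cell 8))
  (Seq (Query 10 (NConst 0) 1 (cell 8))
  (Seq (incr 3 (cell 9))
  (Seq (incr 4 (cell 10))
  (Seq (incr 11 (NConst 0))
  (Seq advance_clock remove_if_done))))).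

Definition rounds : cmd := While (BNLt (NConst 0) (cell 8)) round.

(* Integer array 1 lists the items that have been picked less than [m] times,
   and array 2 holds their positions in it; [m] and the length of the list are
   in cells 0 of arrays 7 and 8.  Arrays 3 and 4 count the answers to the first
   and to the second query of each round, cell 0 of array 11 those of the second
   kind that are still in the list.  Real array 2 holds the logarithmic clock. *)
Definition mnl_learner (k0 : nat) : cmd :=
  Seq (set_target k0) (Seq fill_list rounds).

(** * The set of alive items as a sparse set *)

Section ListRepresentation.
Local Open Scope nat_scope.
Variable n : nat.
Implicit Types (A : {set 'I_n}) (nm : nat -> nat -> nat).

(** Deletions leave stale entries behind in both arrays, so membership is tested by the length
    together with a round trip through the arrays. *)
Record lists A nm : Prop := Lists {
  lists_item : forall p, (p < nm 8 0)%N -> (nm 1 p < n)%N /\ nm 2 (nm 1 p) = p;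
  lists_mem : forall j : 'I_n,
    (j \in A) = (nm 2 j < nm 8 0)%N && (nm 1 (nm 2 j) == j) }.

Lemma lists_slate A nm : lists A nm -> slate n nm 1 (nm 8 0) = A.
Proof.
case=> item mem; apply/finset.setP => j; rewrite finset.inE mem.
apply/mapP/andP => [[p]|[jq /eqP je]].
  rewrite mem_iota /= add0n => pq je; have [_ pp] := item p pq.
  by rewrite je pp pq.
by exists (nm 2 j) => //; rewrite mem_iota.
Qed.

Lemma lists_remove A nm nm' (a : 'I_n) : lists A nm -> a \in A ->
    let l := nm 1 (nm 8 0 - 1)%N in
    nm' 8 0 = (nm 8 0 - 1)%N ->
    (forall i, nm' 1 i = if i == nm 2 a then l else nm 1 i) ->
    (forall i, nm' 2 i = if i == l then nm 2 a else nm 2 i) ->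
  lists (A :\ a)%SET nm'.
Proof.
move=> [item mem] aA l q' e1 e2; move: (aA); rewrite mem => /andP[aq /eqP ap].
have lq : (nm 8 0 - 1 < nm 8 0)%N by lia.
have [ln lp] := item _ lq; rewrite -/l in ln lp.
split=> [p|j].
  rewrite q' => pq; rewrite e1; case: eqP => [->|pa].
    by rewrite e2 eqxx.
  have [|pn pp] := item p; first by lia.
  rewrite e2; case: eqP => // pl; move: lp; rewrite -pl pp; lia.
rewrite finset.inE finset.in_set1 mem q' e2 e1 -(inj_eq val_inj) /=.
have posI : nm 2 j < nm 8 0 -> nm 1 (nm 2 j) == j -> nm 2 j = nm 8 0 - 1 -> j = l :> nat.
  by move=> _ /eqP h pj; rewrite -h pj.
have [jl|jl] := eqVneq (j : nat) l.
  rewrite jl lp -/l !eqxx lq /= !andbT.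
  (* If the removed item is the last one, its position equals the new length, which excludes it. *)
  have [la|la] := eqVneq l a; first by rewrite -la lp ltnn.
  rewrite ltn_neqAle; apply/esym/andP; split; last by lia.
  by apply: contraNneq la => pa; rewrite -ap pa.
have [ja|ja] /= := eqVneq (j : nat) a.
  by rewrite ja eqxx; move: jl; rewrite ja eq_sym => /negbTE ->; rewrite andbF.
have [pj|pj] := eqVneq (nm 2 j) (nm 2 a).
  have [/negbTE aj /negbTE lj] : a != j :> nat /\ l != j by rewrite eq_sym ja eq_sym jl.
  by rewrite pj ap aj lj !andbF.
have [jn|] := boolP (nm 1 (nm 2 j) == j); last by rewrite !andbF.
rewrite !andbT; apply/idP/idP => [jq|]; last by lia.
have : nm 2 j != nm 8 0 - 1 by apply: contra jl => /eqP/(posI jq jn) ->.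
by lia.
Qed.

End ListRepresentation.

(** * The invariant of the main loop *)

Section Rounds.
Variables (R : realType) (n : nat) (M : mnl R n) (m : nat) (eps : R).
Implicit Types (s u : seq 'I_n) (nm : nat -> nat -> nat) (rm : nat -> nat -> R).

Lemma removal_round_rcons s a j :
  removal_round m (rcons s a) j = (removal_round m s j + (j \in alive m s))%N.
Proof.
rewrite /removal_round size_rcons big_ord_recr /= -cats1 take_size_cat //.
by congr (_ + _)%N; apply: eq_bigr => r _; rewrite takel_cat // ltnW.
Qed.

Lemma hits_rcons s u a b r : size u = size s -> (r < size s)%N ->
  hits m (rcons s a) (rcons u b) r = hits m s u r.
Proof.
by move=> us rs; rewrite /hits -!cats1 !takel_cat ?us // ltnW.
Qed.

Lemma hits_last s u a b : size u = size s ->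
  hits m (rcons s a) (rcons u b) (size s) = count (mem (alive m s)) (rcons u b).
Proof.
move=> us; rewrite /hits -cats1 take_size_cat // take_oversize // size_rcons us //.
Qed.

Lemma log_clock_ext (X X' : nat -> R) r : (forall i, (i < r)%N -> X i = X' i) ->
  log_clock n X eps m%:R r = log_clock n X' eps m%:R r.
Proof.
by move=> XX'; apply: eq_bigr => i _; rewrite /log_rate /leap XX'.
Qed.

Lemma final_log_rcons s u a b j : size u = size s -> j \notin alive m s ->
  final_log m eps (rcons s a) (rcons u b) j = final_log m eps s u j.
Proof.
move=> us js; rewrite /final_log removal_round_rcons (negbTE js) addn0.
congr (- _); apply: log_clock_ext => i ij; rewrite hits_rcons //.
exact: leq_trans ij (removal_round_le _ _ _).
Qed.

Lemma removal_round_alive s j : j \in alive m s -> removal_round m s j = size s.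
Proof.
move=> js; rewrite -[RHS]card_ord -sum1_card; apply: eq_bigr => r _.
by rewrite (fintype.subsetP (alive_take_subset m s (ltnW (ltn_ord r)))) // take_size.
Qed.

Lemma count_mem_rcons s a j : count_mem j (rcons s a) = (count_mem j s + (a == j))%N.
Proof. by rewrite -cats1 count_cat /= addn0. Qed.

Lemma alive_rcons s a : a \in alive m s ->
  alive m (rcons s a)
    = if (count_mem a (rcons s a) < m)%N then alive m s else (alive m s :\ a)%SET.
Proof.
rewrite in_alive => am; apply/finset.setP => j.
case: ifP => full; rewrite ?finset.in_setD1 !in_alive.
- have [->|ja] := eqVneq j a; first by rewrite full am.
  by rewrite count_mem_rcons eq_sym (negbTE ja) addn0.
- have [->|ja] := eqVneq j a; first by rewrite full.
  by rewrite count_mem_rcons eq_sym (negbTE ja) addn0.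
Qed.

Lemma count_setD1 (A : {set 'I_n}) u a : a \in A ->
  count (mem A) u = (count (mem (A :\ a)%SET) u + count_mem a u)%N.
Proof.
move=> aA; elim: u => [|j u /= ->] //=; rewrite finset.in_setD1.
have [->|ja] := eqVneq j a; first by rewrite aA /=; lia.
by rewrite /= !add0n addnA.
Qed.

(** [A] is a separate parameter because within a round the counts already include the new answers
    while the list is still the old one. *)
Record represents (A : {set 'I_n}) s u nm rm : Prop := Represents {
  rep_n : nm 0%N 0%N = n;
  rep_m : nm 7%N 0%N = m;
  rep_eps : rm 0%N 0%N = eps;
  rep_lists : lists A nm;
  rep_picks : forall j : 'I_n, nm 3%N j = count_mem j s;
  rep_measures : forall j : 'I_n, nm 4%N j = count_mem j u;
  rep_hits : nm 11%N 0%N = count (mem A) u;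
  rep_clock : rm 2%N 0%N = log_clock n (fun r => (hits m s u r)%:R) eps m%:R (size s);
  rep_output : forall j : 'I_n, j \notin A -> rm 1%N j = final_log m eps s u j }.

Variables (E : config R -> bool).

Lemma exec_remove s u a b nm rm k q t phi :
    size u = size s -> a \in alive m s ->
    represents (alive m s) (rcons s a) (rcons u b) nm rm -> nm 9%N 0%N = a ->
    (forall nm' rm' t', represents (alive m (rcons s a)) (rcons s a) (rcons u b) nm' rm' ->
       fails_within M E (Config k nm' rm' q t') phi) ->
  fails_within M E (Config (remove_if_done :: k) nm rm q t) phi.
Proof.
move=> us aA rep a9 H; apply: fails_within_if => /=.
rewrite a9 (rep_picks rep) (rep_m rep).
have := alive_rcons aA; case: ifP => full aE.
  by apply: fails_within_skip; apply: H; rewrite aE.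
do 4 (apply: fails_within_seq; first [apply: fails_within_rset | apply: fails_within_nset]).
apply: fails_within_nset; apply: H; rewrite aE.
move: rep => [rn r7 re rl r3 r4 r11 rc ro].
split=> //=; rewrite /upd //= ?a9.
- apply: (lists_remove rl aA) => [|i|i] //=; rewrite ?a9 ?eqxx //.
  by rewrite if_same.
- by rewrite r11 r4 (count_setD1 _ aA) addnK.
- move=> j; rewrite finset.in_setD1; have [->|ja] := eqVneq j a => /= jA.
    rewrite eqxx sub0r rc /final_log removal_round_rcons removal_round_alive //.
    by rewrite aA addn1 size_rcons.
  by rewrite (negbTE (_ : j != a :> nat)) // ro.
Qed.

Lemma exec_counts s u (a b : 'I_n) nm rm k q t phi :
    size u = size s -> a \in alive m s -> b \in alive m s ->
    represents (alive m s) s u nm rm ->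
    (forall nm' rm' t', represents (alive m (rcons s a)) (rcons s a) (rcons u b) nm' rm' ->
       fails_within M E (Config k nm' rm' q t') phi) ->
  fails_within M E (Config (Seq (incr 3 (cell 9)) (Seq (incr 4 (cell 10))
    (Seq (incr 11 (NConst 0)) (Seq advance_clock remove_if_done))) :: k)
    (upd (upd nm 9 0 a) 10 0 b) rm q t) phi.
Proof.
move=> us aA bA rep H.
have [rn r7 re rl r3 r4 r11 rc ro] := rep.
do 3 (apply: fails_within_seq; apply: fails_within_nset).
apply: fails_within_seq; apply: fails_within_if.
set nm' := upd _ 11 _ _.
have r11' : nm' 11%N 0%N = count (mem (alive m s)) (rcons u b).
  by rewrite /nm' /upd /= r11 -cats1 count_cat /= bA addn0.
pose rm' := upd rm 2 0 (log_clock n (fun r => (hits m (rcons s a) (rcons u b) r)%:R)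
  eps m%:R (size (rcons s a))).
have rep' : represents (alive m s) (rcons s a) (rcons u b) nm' rm'.
  rewrite /nm' /rm'; split=> //=; rewrite /upd //=.
  - by case: rl => item mem; split.
  - by move=> j; rewrite count_mem_rcons -val_eqE /= eq_sym; case: eqP => [->|_];
      rewrite ?r3 ?addn0.
  - by move=> j; rewrite count_mem_rcons -val_eqE /= eq_sym; case: eqP => [->|_];
      rewrite ?r4 ?addn0.
  - by move=> j jA; rewrite ro // final_log_rcons.
have lam : log_clock n (fun r => (hits m (rcons s a) (rcons u b) r)%:R) eps m%:R
    (size (rcons s a)) = rm 2%N 0%N + (if 64 * (nm' 11%N 0%N)%:R < eps * m%:R
      then ln (16 * n%:R / eps) else 1 / (nm' 11%N 0%N)%:R).
  rewrite size_rcons /log_clock big_ord_recr /= -/(log_clock _ _ _ _ _).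
  rewrite (log_clock_ext (X' := fun r => (hits m s u r)%:R)); last first.
    by move=> i /(hits_rcons a b us) ->.
  by rewrite -rc /log_rate /leap hits_last // r11' div1r.
suff X t' : fails_within M E (Config (remove_if_done :: k) nm' rm' q t') phi.
  have n0 : nm' 0%N 0%N = n by [].
  have m7 : nm' 7%N 0%N = m by [].
  move: lam X; rewrite /rm' => -> X.
  rewrite /= m7 re; move: X; case: ifP => le X; apply: fails_within_rset => /=.
    by rewrite n0 re; exact: X.
  exact: X.
by apply: (exec_remove _ us aA rep' _ H); rewrite /nm' /upd.
Qed.

(** By pigeonhole on [size s + r = n * m], some item is alive exactly as long as rounds remain, so
    the loop runs [r] more times. The two queries of a round average the failure bound just as
    [Erounds] does, down to an indicator at the end. *)
Lemma exec_rounds r s u nm rm q t :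
    (forall c, queries c = (q + 2 * r)%N -> d1 M (output n c) <= eps -> E c) ->
    (0 < m)%N -> size u = size s -> (size s + r = n * m)%N ->
    (forall j, (count_mem j s <= m)%N) -> represents (alive m s) s u nm rm ->
  fails_within M E (Config [:: rounds] nm rm q t)
    (Erounds M m r s (fun t' u' =>
       (all_removed m (s ++ t') && ~~ accurate M m eps (s ++ t') (u ++ u'))%:R)).
Proof.
move=> HE m0; elim: r s u nm rm q t HE => [|r IH] s u nm rm q t HE us sr sm rep;
  apply: fails_within_while; rewrite [beval _ _ _]/=.
- have rem : all_removed m s.
    apply/forallP => j; rewrite eqn_leq sm /= leqNgt; apply/negP => jm.
    suff : (\sum_j count_mem j s < \sum_(j < n) m)%N.
      by rewrite sum_count_mem sum_nat_const card_ord -sr addn0 ltnn.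
    rewrite (bigD1 j) //= [ltnRHS](bigD1 j) //= -addSn leq_add //.
    exact: leq_sum.
  have q0 : nm 8%N 0%N = 0%N.
    case qE : (nm 8%N 0%N) => [//|q']; have [item mem] := rep_lists rep.
    have [|in0 ip0] := item 0%N; first by rewrite qE.
    have := mem (Ordinal in0); rewrite in_alive /= ip0 eqxx qE (eqP (forallP rem _)).
    by rewrite ltnn.
  rewrite q0 /= !cats0 rem /=.
  have [acc|_] := boolP (accurate _ _ _ _ _); last exact: fails_within_ge1.
  apply: fails_within_halt => //; apply: HE; first by rewrite muln0 addn0.
  rewrite /output /=; move: acc; rewrite /accurate.
  congr (d1 M (mnl_of_logs _) <= _); apply/funext => j.
  by rewrite (rep_output rep) // in_alive (eqP (forallP rem j)) ltnn.
- have [j jA] : exists j, j \in alive m s.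
    apply/existsP; rewrite -[X in is_true X]negbK negb_exists; apply/negP => /forallP none.
    have : (\sum_(j < n) m <= \sum_j count_mem j s)%N.
      by apply: leq_sum => j _; rewrite leqNgt -in_alive.
    by rewrite sum_count_mem sum_nat_const card_ord -sr addnS; lia.
  have q0 : (0 < nm 8%N 0%N)%N.
    by have [_ mem] := rep_lists rep; move: jA; rewrite mem => /andP[]; lia.
  have slateE : slate n nm 1 (nm 8%N 0%N) = alive m s by exact: lists_slate (rep_lists rep).
  have A0 : alive m s != finset.set0 by apply/finset.set0Pn; exists j.
  rewrite q0; apply: fails_within_seq.
  rewrite /= -{1}slateE; apply: fails_within_query; rewrite /= slateE // => a aA.
  apply: fails_within_seq.
  have slateE' : slate n (upd nm 9 0 a) 1 (nm 8%N 0%N) = alive m s by rewrite -slateE.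
  rewrite -{1}slateE'; apply: fails_within_query; rewrite /= slateE' // => b bA.
  apply: (exec_counts _ us aA bA rep) => nm' rm' t' rep'.
  have := IH (rcons s a) (rcons u b) nm' rm' q.+2 t'.
  rewrite !size_rcons us => {}IH.
  rewrite (_ : (fun t0 u0 => _) = (fun t0 u0 => (all_removed m (rcons s a ++ t0)
    && ~~ accurate M m eps (rcons s a ++ t0) (rcons u b ++ u0))%:R)); last first.
    by apply/funext => t0; apply/funext => u0; rewrite !cat_rcons.
  apply: IH => // [c||j']; last 2 first.
  by rewrite addSnnS.
  rewrite count_mem_rcons; case: eqVneq => [<-|_]; last by rewrite addn0.
    by rewrite addn1; move: aA; rewrite in_alive.
  by move=> qc; apply: HE; rewrite qc; lia.
Qed.

End Rounds.

(** * The target and the initial list *)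

Section Initialization.
Variables (R : realType) (n : nat) (M : mnl R n) (E : config R -> bool).
Implicit Types (nm : nat -> nat -> nat).
Hypothesis n0 : (0 < n)%N.

Lemma exec_dummy nm rm k q t phi : nm 6%N 0%N = 0%N ->
    (forall v, fails_within M E (Config k (upd nm 5 0 v) rm q.+1 t.+1) phi) ->
  fails_within M E (Config (dummy_query :: k) nm rm q t) phi.
Proof.
move=> nm6 H; have S0 : slate n nm 6 1 != finset.set0.
  by apply/finset.set0Pn; exists (Ordinal n0); rewrite finset.inE /= nm6.
rewrite -[phi]mul1r -(sum_mnl_prob M S0) mulr_suml.
exact: fails_within_query.
Qed.

Lemma exec_set_target k0 m nm rm k q t phi :
    (forall p, (k0%:R * (k0%:R * k0%:R) * ln (n%:R / rm 0%N 1%N)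
       / (rm 0%N 0%N * (rm 0%N 0%N * rm 0%N 0%N)) <= p%:R) = (m <= p)%N) ->
    nm 0%N 0%N = n -> (nm 7%N 0%N <= m)%N ->
    (forall a i, a \notin [:: 0; 5; 7]%N -> nm a i = 0%N) ->
    (forall nm' t', nm' 0%N 0%N = n -> nm' 7%N 0%N = m ->
       (forall a i, a \notin [:: 0; 5; 7]%N -> nm' a i = 0%N) ->
       fails_within M E (Config k nm' rm (q + (m - nm 7%N 0%N)) t') phi) ->
  fails_within M E (Config (set_target k0 :: k) nm rm q t) phi.
Proof.
move=> target; move dE : (m - nm 7 0)%N => d.
elim: d nm q t dE => [|d IH] nm q t dE nmn le zero H;
  apply: fails_within_while; rewrite /= nmn ltNge target.
- have -> : (m <= nm 7 0)%N by lia.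
  by rewrite -[q]addn0; apply: H => //; lia.
- have -> : (m <= nm 7 0)%N = false by lia.
  apply: fails_within_seq; apply: fails_within_nset; apply: exec_dummy => [|v].
    by rewrite /upd /= zero.
  apply: IH; rewrite /upd //=; [lia|lia| |].
    move=> a i; rewrite !inE !negb_or => /and3P[a0 a5 a7].
    by rewrite (negbTE a5) (negbTE a7) /= zero // !inE !negb_or a0 a5 a7.
  by move=> nm' t' h1 h2 h3; rewrite addSnnS; exact: H.
Qed.

Lemma exec_fill_list m nm rm k q t phi :
    nm 0%N 0%N = n -> nm 7%N 0%N = m -> (nm 8%N 0%N <= n)%N ->
    (forall p, (p < nm 8%N 0%N)%N -> nm 1%N p = p /\ nm 2%N p = p) ->
    (forall a i, a \in [:: 3; 4; 6; 11]%N -> nm a i = 0%N) ->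
    (forall nm' t', nm' 0%N 0%N = n -> nm' 7%N 0%N = m -> nm' 8%N 0%N = n ->
       (forall p, (p < n)%N -> nm' 1%N p = p /\ nm' 2%N p = p) ->
       (forall a i, a \in [:: 3; 4; 6; 11]%N -> nm' a i = 0%N) ->
       fails_within M E (Config k nm' rm (q + (n - nm 8%N 0%N)) t') phi) ->
  fails_within M E (Config (fill_list :: k) nm rm q t) phi.
Proof.
move dE : (n - nm 8 0)%N => d.
elim: d nm q t dE => [|d IH] nm q t dE nmn nmm le filled zero H;
  apply: fails_within_while; rewrite /= nmn.
- have e : nm 8%N 0%N = n by lia.
  by rewrite e ltnn -[q]addn0; apply: H => //; rewrite -e.
- have -> : (nm 8 0 < n)%N by lia.
  do 2 (apply: fails_within_seq; apply: fails_within_nset).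
  apply: fails_within_seq; apply: fails_within_nset; apply: exec_dummy => [|v].
    by rewrite /upd /= zero.
  apply: IH; rewrite /upd //=; [lia|lia| | |].
  + move=> p; rewrite addn1 ltnS leq_eqVlt => /orP[/eqP ->|pk]; first by rewrite eqxx.
    by have [p1 p2] := filled p pk; rewrite p1 p2; case: eqP.
  + by move=> a i; rewrite !inE => /or4P[] /eqP -> /=; apply: zero.
  + by move=> nm' t' h1 h2 h3 h4 h5; rewrite addSnnS; exact: H.
Qed.

Lemma exec_learner k0 m eps delta :
    (forall p, (k0%:R * (k0%:R * k0%:R) * ln (n%:R / delta)
       / (eps * (eps * eps)) <= p%:R) = (m <= p)%N) ->
    (0 < m)%N ->
    (forall c, queries c = (m + n + 2 * (n * m))%N -> d1 M (output n c) <= eps -> E c) ->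
  fails_within M E (init (mnl_learner k0) n eps delta)
    (Erounds M m (n * m) [::] (fun t u => (all_removed m t && ~~ accurate M m eps t u)%:R)).
Proof.
move=> target m0 HE; rewrite /init; apply: fails_within_seq.
pose nm := upd (fun _ _ => 0%N) 0 0 n.
pose rm : nat -> nat -> R := upd (upd (fun _ _ => 0) 0 0 eps) 0 1 delta.
have zero : forall a i, a \notin [:: 0; 5; 7]%N -> nm a i = 0%N.
  by move=> a i; rewrite !inE !negb_or /nm /upd => /and3P[/negbTE -> _ _].
refine (@exec_set_target k0 m nm rm _ _ _ _ target erefl (leq0n m) zero _).
move=> {zero} nm1 t1 nmn nmm zero; apply: fails_within_seq.
have nm8 : nm1 8%N 0%N = 0%N by rewrite zero.
have empty : forall p, (p < nm1 8 0)%N -> nm1 1%N p = p /\ nm1 2%N p = p by rewrite nm8.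
have zero1 : forall a i, a \in [:: 3; 4; 6; 11]%N -> nm1 a i = 0%N.
  by move=> a i a'; apply: zero; move: a'; rewrite !inE => /or4P[] /eqP ->.
have le8 : (nm1 8 0 <= n)%N by rewrite nm8.
refine (exec_fill_list _ nmn nmm le8 empty zero1 _).
rewrite nm8 => nm' t' {nmn nmm zero nm8 empty zero1 le8}nmn nmm nm8 filled zero.
have al : alive m [::] = [set: 'I_n]%SET by apply/finset.setP => j; rewrite in_alive finset.inE.
have rep : represents m eps (alive m ([::] : seq 'I_n)) [::] [::] nm' rm.
  rewrite al; split.
  - exact: nmn.
  - exact: nmm.
  - by [].
  - split=> [p|j]; rewrite nm8; first by move=> /[dup] /filled[-> ->] ->.
    by have [h1 h2] := filled j (ltn_ord j); rewrite h2 h1 eqxx ltn_ord finset.inE.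
  - by move=> j; rewrite zero.
  - by move=> j; rewrite zero.
  - by rewrite zero.
  - by rewrite /log_clock big_ord0.
  - by move=> j; rewrite finset.inE.
have HE' c : queries c = (0 + (m - 0) + (n - 0) + 2 * (n * m))%N ->
    d1 M (output n c) <= eps -> E c.
  by move=> qc; apply: HE; rewrite qc; lia.
have sm : forall j : 'I_n, (count_mem j [::] <= m)%N by [].
have sz : (size ([::] : seq 'I_n) + n * m = n * m)%N by [].
have := exec_rounds t' HE' m0 erefl sz sm rep.
by [].
Qed.

End Initialization.

Lemma least_nat_above (R : realType) (x : R) : 0 < x ->
  exists m : nat, [/\ (0 < m)%N, x <= m%:R, m%:R <= x + 1
    & forall p : nat, (x <= p%:R) = (m <= p)%N].
Proof.
move=> x0; have ex : exists p : nat, x <= p%:R.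
  by exists (Num.Def.archi_bound x); rewrite ltW // Num.Theory.archi_boundP // ltW.
have [m xm mmin] := ex_minnP ex.
have m0 : (0 < m)%N by rewrite -(ltr0n R) (lt_le_trans x0).
exists m; split=> // [|p].
  rewrite -(prednK m0) -natr1 lerD2r leNgt; apply/negP => /ltW/mmin.
  by rewrite leqNgt prednK ?leqnn.
apply/idP/idP => [/mmin //|mp]; apply: le_trans xm _.
by rewrite ler_nat.
Qed.

(** * Running time *)

Section Time.
Local Open Scope nat_scope.

Fixpoint asks (c : cmd) : bool :=
  match c with
  | Query _ _ _ _ => true
  | Seq c1 c2 => asks c1 || asks c2
  | If _ c1 c2 => asks c1 && asks c2
  | _ => false
  end.

(** If every loop body is sure to query, the time between two queries is bounded by the code that is
    on the stack. *)
Fixpoint loops_ask (c : cmd) : bool :=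
  match c with
  | Seq c1 c2 | If _ c1 c2 => loops_ask c1 && loops_ask c2
  | While _ c => asks c && loops_ask c
  | _ => true
  end.

(* Bounds the time until the next query when [r] bounds it for the commands
   that follow. *)
Fixpoint wait (c : cmd) (r : nat) : nat :=
  match c with
  | Query _ _ _ _ => 1
  | Seq c1 c2 => (wait c1 (wait c2 r)).+1
  | If _ c1 c2 => (maxn (wait c1 r) (wait c2 r)).+1
  | While _ c => (maxn (wait c 0) r).+1
  | _ => r.+1
  end.

Fixpoint span (c : cmd) : nat :=
  match c with
  | Seq c1 c2 => (span c1 + span c2).+1
  | If _ c1 c2 => (maxn (span c1) (span c2)).+1
  | While _ c => (span c).+1
  | _ => 1
  end.

(* Bounds the total span of the code stack during the execution of a command. *)
Fixpoint height (c : cmd) : nat :=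
  match c with
  | Seq c1 c2 => maxn (span c1 + span c2).+1 (maxn (height c1 + span c2) (height c2))
  | If _ c1 c2 => (maxn (height c1) (height c2)).+1
  | While _ c => height c + (span c).+1
  | _ => 1
  end.

Definition spans (k : seq cmd) := sumn [seq span c | c <- k].
Definition stack_wait (k : seq cmd) := foldr wait 0 k.
Fixpoint stack_height (k : seq cmd) : nat :=
  if k is c :: k' then maxn (height c + spans k') (stack_height k') else 0.

(** A command that is sure to query shields whatever follows it, which justifies the argument [0]
    for loop bodies in [wait]. *)
Lemma asks_wait c r r' : asks c -> wait c r = wait c r'.
Proof.
elim: c r r' => //= [c1 IH1 c2 IH2|_ c1 IH1 c2 IH2] r r'.
- by case/orP => [/IH1 e|/IH2 e]; congr _.+1; [apply: e|rewrite (e _ r')].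
- by case/andP => /IH1 e1 /IH2 e2; rewrite (e1 r r') (e2 r r').
Qed.

Lemma wait_span c r : wait c r <= span c + r.
Proof.
elim: c r => //= [c1 IH1 c2 IH2|_ c1 IH1 c2 IH2|_ c IH] r.
- by have := IH1 (wait c2 r); have := IH2 r; lia.
- by have := IH1 r; have := IH2 r; lia.
- by have := IH 0; lia.
Qed.

Lemma span_height c : span c <= height c.
Proof. by elim: c => //= *; lia. Qed.

Lemma stack_wait_height k : stack_wait k <= stack_height k.
Proof.
have spansP : stack_wait k <= spans k.
  by elim: k => //= c k IH; rewrite (leq_trans (wait_span _ _)) // leq_add2l.
by case: k spansP => //= c k; have := span_height c; rewrite /spans /=; lia.
Qed.

(** An amortized bound: a step without a query lowers the wait by at least the unit of time it
    takes, and a query resets the wait to at most [H] while the right-hand side grows by [H.+1]. *)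
Definition timely (R : realType) (H : nat) (c : config R) :=
  [/\ all loops_ask (Defs.code c), stack_height (Defs.code c) <= H
    & time c + stack_wait (Defs.code c) <= H.+1 * (queries c).+1].

Lemma timely_step (R : realType) n (M : mnl R n) H c x :
  timely H c -> List.In x (step M c) -> timely H x.2.
Proof.
have in_map (I : Type) (f : I -> R) (g : I -> config R) s :
    (forall i, timely H (g i)) -> List.In x [seq (f i, g i) | i <- s] -> timely H x.2.
  by move=> Hg; elim: s => [|i s IH] //= [<-|/IH//] /=.
case: c => [[|[|a i e|a i e|a i e|a i s e|c1 c2|b c1 c2|b c1] k] nm rm q t];
  rewrite /timely /=.
- by move=> [al ht tm] [<-|//].
- by move=> [al ht tm] [<-|//]; split=> //=; lia.
- by move=> [al ht tm] [<-|//]; split=> //=; lia.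
- by move=> [al ht tm] [<-|//]; split=> //=; lia.
- move=> [al ht tm]; case: eqP => [_ [<-|//]|_]; first by split.
  by apply: (in_map _ (fun=> _)) => v; split=> //=; lia.
- move=> [al ht tm]; case: eqP => [_ [<-|//]|_]; first by split.
  apply: (in_map _ (mnl_prob M _)) => v; split=> //=; first by lia.
  by have := stack_wait_height k; lia.
- move=> [/andP[/andP[l1 l2] lk] ht tm] [<-|//]; split; rewrite /= ?l1 ?l2 ?lk //; last by lia.
  by move: ht; rewrite /spans /=; lia.
- move=> [/andP[/andP[l1 l2] lk] ht tm] [<-|//]; split; case: ifP => _; rewrite /= ?l1 ?l2 ?lk //; lia.
- move=> [/andP[/andP[a1 l1] lk] ht tm] [<-|//]; split; case: ifP => _; rewrite /= ?a1 ?l1 ?lk //.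
  + by move: ht; rewrite /spans /=; lia.
  + lia.
  + by rewrite (asks_wait _ 0 a1); lia.
  + lia.
Qed.

End Time.

Lemma time_bound (R : realType) n (M : mnl R n) p (eps delta : R) T : loops_ask p ->
  prob_at M T (fun c => (time c)%:R <= (height p).+1%:R * ((queries c)%:R + 1) :> R)
    (init p n eps delta) = 1.
Proof.
move=> lp; apply: (@prob_at_invariant _ _ _ (timely (height p))).
- by move=> c x; exact: timely_step.
- move=> c [_ _ tm]; rewrite natr1 -natrM ler_nat.
  by rewrite (leq_trans _ tm) // leq_addr.
- split; rewrite /= ?lp ?addn0 ?maxn0 //.
  rewrite add0n muln1 (leq_trans (wait_span _ _)) // addn0.
  exact: leq_trans (span_height _) _.
Qed.

(** * The theorem *)

(** [m] occurs in the logarithm that it has to dominate. For [L = ln (n / delta)], bounded below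
    since [n >= 2], that logarithm is at most a constant times [L / eps], whereas [eps ^ 2 * m] is
    at least [2 ^ 33 * L / eps]. *)
Lemma target_large (R : realType) (n m : nat) (eps delta : R) :
    let x := 2 ^+ 33 * ln (n%:R / delta) / eps ^+ 3 in
    (1 < n)%N -> (0 < m)%N -> 0 < eps < 1 -> 0 < delta < 1 -> x <= m%:R <= x + 1 ->
  2 ^+ 22 * ln (4 * n%:R * m%:R / delta) <= eps ^+ 2 * m%:R /\ m%:R <= 2 * x.
Proof.
move=> x n1 m0 /andP[e0 e1] /andP[d0 d1] /andP[xm mx].
have n2 : 2 <= n%:R :> R by rewrite ler_nat.
have nd2 : 2 <= n%:R / delta by rewrite ler_pdivlMr // (le_trans _ n2) // ler_piMr // ltW.
have mr : 0 < m%:R :> R by rewrite ltr0n.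
have e3 : 0 < eps ^+ 3 by rewrite exprn_gt0.
set L := ln (n%:R / delta) in x xm mx *.
have L0 : 3 / 16 <= L.
  rewrite -[leLHS]expRK ler_ln ?posrE ?expR_gt0 //; last by lra.
  rewrite (le_trans _ nd2) // (_ : 3 / 16 = 4^-1 - 4^-1 ^+ 2); last by field.
  have le4 := @expR_sub_sqr_le R 4^-1.
  by apply: le_trans (le4 _) _; [rewrite lexx andbT|]; lra.
have Lpos : 0 < L by lra.
have x1 : 1 <= x.
  rewrite /x ler_pdivlMr // mul1r (@le_trans _ _ 1) ?exprn_ile1 ?(ltW e0) ?(ltW e1) //.
  by lra.
have m2x : m%:R <= 2 * x by lra.
split=> //.
have eV : 1 <= eps^-1 by rewrite invf_ge1 // ltW.
have lnm : ln (4 * m%:R) <= 72 + 3 * eps^-1 + L.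
  (* The argument is [8 * x], as [8 * 2 ^ 33 = (2 ^ 12) ^ 3]; written this way, its logarithm splits
     into terms to which [ln y < y] applies. *)
  apply: (@le_trans _ _ (ln ((2 ^+ 12 / eps) ^+ 3 * L))).
    rewrite ler_ln ?posrE ?mulr_gt0 ?exprn_gt0 ?invr_gt0 //.
    apply: (@le_trans _ _ (8 * x)); first by lra.
    rewrite le_eqVlt; apply/orP; left; apply/eqP; rewrite /x; field.
    by rewrite gt_eqF.
  have y0 : 0 < 2 ^+ 12 / eps by rewrite divr_gt0 // exprn_gt0.
  have p12 : 0 < 2 ^+ 12 :> R by rewrite exprn_gt0.
  have lny : ln (2 ^+ 12 / eps) = ln 2 *+ 12 + ln eps^-1.
    by rewrite lnM ?posrE ?invr_gt0 // lnXn.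
  rewrite lnM ?posrE ?exprn_gt0 // lnXn // lny.
  have l2 : ln 2 < 2 :> R by exact: ln_sublinear.
  have lL := ln_sublinear Lpos.
  have le := @ln_sublinear R eps^-1; rewrite invr_gt0 in le.
  have {}le := le e0; lra.
have -> : 4 * n%:R * m%:R / delta = (n%:R / delta) * (4 * m%:R) by ring.
have nr : 0 < n%:R :> R by lra.
rewrite lnM ?posrE ?mulr_gt0 ?invr_gt0 // -/L.
have mE : 2 ^+ 33 * (L * eps^-1) <= eps ^+ 2 * m%:R.
  have -> : 2 ^+ 33 * (L * eps^-1) = eps ^+ 2 * x by rewrite /x; field; rewrite gt_eqF.
  by rewrite ler_wpM2l ?sqr_ge0.
apply: le_trans mE.
have h1 : L <= L * eps^-1 by rewrite ler_peMr // ltW.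
have h2 : 3 / 16 * eps^-1 <= L * eps^-1 by rewrite ler_wpM2r // invr_ge0 ltW.
by lra.
Qed.

Lemma d1_singleton (R : realType) (M M' : mnl R 1) : d1 M M' <= 0.
Proof.
apply: d1_le => // S /finset.set0Pn[h hS]; apply: (l1_dist_le hS).
rewrite mul0r mul0r big1 // => i _.
by rewrite (ord1 i) (ord1 h) !divff ?gt_eqF ?weight_gt0 // subrr normr0.
Qed.

(* At n = 1 the factor 1 / ln n is infinite, and so is the query bound.
   The last conjunct says that almost surely, at every moment of the execution,
   the elapsed time is at most proportional to the number of queries made
   (plus one, to allow for the work that precedes the first query). *)
Theorem theorem6p14 (R : realType) :
  exists (p : cmd) (C K : R),
    forall (n : nat) (eps delta : R) (M : mnl R n),
      (0 < n)%N -> 0 < eps < 1 -> 0 < delta < 1 ->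
      1 - delta <=
        prob_halt M
          (fun c => ((1 < n)%N ==>
                       ((queries c)%:R <= C * query_bound n eps delta)) &&
                    (d1 M (output n c) <= eps))
          (init p n eps delta)
      /\
      forall T : nat,
        prob_at M T (fun c => (time c)%:R <= K * ((queries c)%:R + 1))
          (init p n eps delta) = 1.
Proof.
pose p := mnl_learner (2 ^ 11).
(* At most [4 * n * m] queries with [m <= 2 * x] give the constant [4 * 2 * 2 ^ 33 = 2 ^ 36]. *)
exists p, (2 ^+ 36), (height p).+1%:R => n eps delta M n0 eps01 delta01.
split; last by move=> T; exact: time_bound.
have [[e0 e1] [dl0 dl1]] := (andP eps01, andP delta01).
set x := 2 ^+ 33 * ln (n%:R / delta) / eps ^+ 3.
have nr : 1 <= n%:R :> R by rewrite ler1n.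
have L0 : 0 < ln (n%:R / delta).
  by rewrite ln_gt0 // ltr_pdivlMr // mul1r (lt_le_trans dl1).
have x0 : 0 < x by rewrite divr_gt0 ?mulr_gt0 ?exprn_gt0.
have [m [m0 xm mx target]] := least_nat_above x0.
apply: le_prob_halt.
apply: (@fails_within_le _ _ _ _ _ (Erounds M m (n * m) [::]
    (fun t u => (all_removed m t && ~~ accurate M m eps t u)%:R))); last first.
  apply: exec_learner => //.
    move=> r; rewrite -target /x natrX; congr (_ <= _); field.
    by rewrite gt_eqF.
  move=> c qc acc; rewrite acc andbT; apply/implyP => n1.
  have [_ m2x] := @target_large R n m eps delta n1 m0 eps01 delta01 (introT andP (conj xm mx)).
  rewrite qc; apply: (@le_trans _ _ (n%:R * m%:R * 4)).
    rewrite -!natrM ler_nat.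
    have : (n <= n * m)%N by rewrite leq_pmulr.
    have : (m <= n * m)%N by rewrite leq_pmull.
    by move: (n * m)%N => k; clear; lia.
  apply: (@le_trans _ _ (2 ^+ 36 * (n%:R * ln (n%:R / delta) * (1 / eps ^+ 3)))).
    rewrite (_ : 2 ^+ 36 * _ = n%:R * (2 * x) * 4); last by rewrite /x; field; rewrite gt_eqF.
    by rewrite ler_wpM2r // ler_wpM2l // (le_trans _ nr).
  rewrite ler_wpM2l ?exprn_ge0 // /query_bound ler_wpM2l ?mulr_ge0 ?(ltW L0) //.
  rewrite lerDl divr_ge0 ?ln_ge0 // ler_pdivlMr // mul1r ltW //.
have [n1|n1] := ltnP 1 n; last first.
  (* For [n = 1] the logarithm [ln (n / delta)] can be arbitrarily small, outside the reach of
     [target_large], but then every output is exact. *)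
  have nE : n = 1%N by lia.
  subst n; have acc t u : accurate M m eps t u by exact: le_trans (d1_singleton _ _) (ltW e0).
  rewrite (_ : (fun t u => _) = (fun _ _ => 0)) ?Erounds0 ?(ltW dl0) //.
  by apply/funext => t; apply/funext => u; rewrite acc andbF.
have [large _] := @target_large R n m eps delta n1 m0 eps01 delta01 (introT andP (conj xm mx)).
exact: Erounds_failure_le.
Qed.
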